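(* Let $m\geqslant2$ be an integer and let $(W,S)$ be a Coxeter system of type $I_2(m)$ with $S=\{s,t\}$, i.e. $W=\langle s,t\mid s^2=t^2=(st)^m=1\rangle$. Let $J\subseteq S$ and $\mathscr I\subseteq W$. Then $(\mathscr I,J)$ is a $W$-graph ideal if and only if one of the following alternatives is satisfied (where $l,h,k$ denote nonnegative integers): (i) $(\mathscr I,J)=(\{1\},S)$; (ii) $(\mathscr I,J)=(D_{\{s\}},\{s\})$; (iii) $(\mathscr I,J)=(\{[..st]_l\mid l\leqslant k\},\{s\})$, where $k+2$ divides $m$; (iv) $(\mathscr I,J)=(D_{\{t\}},\{t\})$; (v) $(\mathscr I,J)=(\{[..ts]_l\mid l\leqslant k\},\{t\})$, where $k+2$ divides $m$; (vi) $(\mathscr I,J)=(W,\emptyset)$; (vii) $(\mathscr I,J)=(\{[..st]_l\mid l\leqslant h\}\cup\{[..ts]_l\mid l\leqslant k\},\emptyset)$, where $h+1$ and $k+1$ divide $m$.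
   Context: For elements $x,y$ of a semigroup (with identity), $[..xy]_k$ denotes $(xy)^{k/2}$ if $k$ is even and $y(xy)^{(k-1)/2}$ if $k$ is odd (the alternating product of $k$ factors ending in $y$; $[..xy]_0=1$). Coxeter groups and Hecke algebras. $(W,S)$ is a Coxeter system with length function $l$; $\leqslant$ is the Bruhat order, and $\leqslant_L$ is the left weak order: $v\leqslant_L w$ iff $l(w)=l(wv^{-1})+l(v)$. An ideal of $(W,\leqslant_L)$ is a nonempty subset $\mathscr I\subseteq W$ such that $v\leqslant_L w\in\mathscr I$ implies $v\in\mathscr I$. For $J\subseteq S$, $D_J=\{w\in W\mid l(ws)>l(w)\text{ for all }s\in J\}$. $\mathcal A=\mathbb Z[q,q^{-1}]$, $\mathcal A^+=\mathbb Z[q]$, and $a\mapsto\overline a$ is the ring automorphism of $\mathcal A$ with $\overline q=q^{-1}$. The Hecke algebra $\mathcal H=\mathcal H(W)$ is the associative $\mathcal A$-algebra generated by $\{T_s\mid s\in S\}$ with relations $T_s^2=1+(q-q^{-1})T_s$ and the braid relations $T_sT_tT_s\cdots=T_tT_sT_t\cdots$ ($m(s,t)$ factors on each side, $m(s,t)$ the order of $st$). It has the $\mathcal A$-semilinear ring involution $h\mapsto\overline h$ with $\overline{T_s}=T_s^{-1}=T_s-(q-q^{-1})$. $W$-graph ideals. The pair $(\mathscr I,J)$, with $\mathscr I\subseteq W$ and $J\subseteq S$, is a $W$-graph ideal if $\mathscr I$ is an ideal of $(W,\leqslant_L)$ with $\mathscr I\subseteq D_J$ and the following holds. For $w\in\mathscr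 I$ put $\mathrm{SD}(w)=\{r\in S\mid rw<w\}$, $\mathrm{SA}(w)=\{r\mid rw>w,\ rw\in\mathscr I\}$, $\mathrm{WD}(w)=\{r\mid rw>w,\ rw\notin D_J\}$, $\mathrm{WA}(w)=\{r\mid rw>w,\ rw\in D_J\setminus\mathscr I\}$. There is an $\mathcal H$-module $\mathscr S$ such that: (a) $\mathscr S$ has an $\mathcal A$-basis $\{b_w\mid w\in\mathscr I\}$ with $T_rb_w=b_{rw}$ if $r\in\mathrm{SA}(w)$; $T_rb_w=b_{rw}+(q-q^{-1})b_w$ if $r\in\mathrm{SD}(w)$; $T_rb_w=-q^{-1}b_w$ if $r\in\mathrm{WD}(w)$; $T_rb_w=qb_w-\sum_{y\in\mathscr I,\,y<rw}r^{(r)}_{y,w}b_y$ for some polynomials $r^{(r)}_{y,w}\in q\mathcal A^+$ if $r\in\mathrm{WA}(w)$; and (b) $\mathscr S$ admits an $\mathcal A$-semilinear involution $\alpha\mapsto\overline\alpha$ with $\overline{b_1}=b_1$ and $\overline{h\alpha}=\overline h\,\overline\alpha$ for all $h\in\mathcal H$, $\alpha\in\mathscr S$. *)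

(* Defs.v *)
From HB Require Import structures.
From mathcomp Require Import all_boot all_order all_algebra all_fingroup.
From mathcomp Require Import generic_quotient boolp.

Set Implicit Arguments.
Unset Strict Implicit.
Unset Printing Implicit Defensive.

Import GRing.Theory.
Local Open Scope ring_scope.
Local Open Scope quotient_scope.

(* A = Z[q, q^-1], realized inside the fraction field of Z[X]. *)

Definition laurent_pred : {pred {fraction {poly int}}} :=
  fun x => `[< exists (p : {poly int}) (n : nat),
    x = tofrac p / tofrac 'X ^+ n >].

Lemma fracX_neq0 : tofrac ('X : {poly int}) != 0.
Proof. by rewrite tofrac_eq0 polyX_eq0. Qed.

Lemma laurent_predP x :
  reflect (exists (p : {poly int}) (n : nat), x = tofrac p / tofrac 'X ^+ n)
          (x \in laurent_pred).
Proof. exact: asboolP. Qed.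

Fact laurent_subring : subring_closed laurent_pred.
Proof.
split.
- by apply/laurent_predP; exists 1, 0%N; rewrite expr0 divr1 tofrac1.
- move=> _ _ /laurent_predP[p [n ->]] /laurent_predP[p' [n' ->]].
  apply/laurent_predP; exists (p * 'X^n' - p' * 'X^n), (n + n')%N.
  rewrite tofracB !tofracM !tofracXn exprD mulrBl.
  have nz k : tofrac ('X : {poly int}) ^+ k != 0.
    by rewrite expf_neq0 // fracX_neq0.
  congr (_ - _); first by rewrite -mulf_div (divff (nz n')) mulr1.
  by rewrite [tofrac 'X ^+ n * _]mulrC -mulf_div (divff (nz n)) mulr1.
- move=> _ _ /laurent_predP[p [n ->]] /laurent_predP[p' [n' ->]].
  apply/laurent_predP; exists (p * p'), (n + n')%N.
  by rewrite tofracM exprD mulf_div.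
Qed.

HB.instance Definition _ :=
  GRing.isSubringClosed.Build _ laurent_pred laurent_subring.

Record laurent :=
  Laurent { laurent_val : {fraction {poly int}}; _ : laurent_val \in laurent_pred }.

HB.instance Definition _ := [isSub for laurent_val].
HB.instance Definition _ := [Choice of laurent by <:].
HB.instance Definition _ := [SubChoice_isSubComNzRing of laurent by <:].

Fact q_in : tofrac 'X \in laurent_pred.
Proof. by apply/laurent_predP; exists 'X, 0%N; rewrite expr0 divr1. Qed.

Fact qV_in : (tofrac 'X)^-1 \in laurent_pred.
Proof. by apply/laurent_predP; exists 1, 1%N; rewrite expr1 tofrac1 mul1r. Qed.

Definition q : laurent := Laurent q_in.
Definition qV : laurent := Laurent qV_in.
Definition xi : laurent := q - qV.

Lemma mulqV : q * qV = 1.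
Proof. by apply: val_inj; rewrite /= divff // fracX_neq0. Qed.

(* An element of A+ = Z[q]. *)
Definition polyq (p : {poly int}) : laurent := (map_poly intr p).[q].

Lemma laurent_valD a b : laurent_val (a + b) = laurent_val a + laurent_val b.
Proof. by []. Qed.
Lemma laurent_valM a b : laurent_val (a * b) = laurent_val a * laurent_val b.
Proof. by []. Qed.
Lemma laurent_valX a n : laurent_val (a ^+ n) = laurent_val a ^+ n.
Proof. exact: (rmorphXn (val : laurent -> _)). Qed.
Lemma laurent_val_int c : laurent_val c%:~R = c%:~R.
Proof. exact: (rmorph_int (val : laurent -> _)). Qed.

Lemma polyq_val p : laurent_val (polyq p) = tofrac p.
Proof.
elim/poly_ind: p => [|p c IHp]; first by rewrite /polyq rmorph0 horner0 tofrac0.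
have -> : polyq (p * 'X + c%:P) = polyq p * q + c%:~R.
  by rewrite /polyq rmorphD rmorphM /= map_polyX map_polyC !hornerE.
rewrite laurent_valD laurent_valM IHp laurent_val_int tofracD tofracM.
by rewrite -[in c%:P](intz c) !rmorph_int.
Qed.

Lemma laurentP (a : laurent) : exists (p : {poly int}) (n : nat),
  a = polyq p * qV ^+ n.
Proof.
have /laurent_predP[p [n e]] := valP a; exists p, n; apply: val_inj.
by rewrite e [val _]laurent_valM laurent_valX polyq_val exprVn.
Qed.

(* The ring morphism from A that sends q to u and q^-1 to v. *)
Section LaurentEval.
Variables (B : comNzRingType) (u v : B).

Definition laurent_eval (_ : u * v = 1) (a : laurent) : B :=
  let (p, h) := cid (laurentP a) in let (n, _) := cid h in
  (map_poly intr p).[u] * v ^+ n.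

Hypothesis uv : u * v = 1.

Lemma laurent_evalE p n :
  laurent_eval uv (polyq p * qV ^+ n) = (map_poly intr p).[u] * v ^+ n.
Proof.
rewrite /laurent_eval; case: cid => p' h; case: cid => n' {h} /(congr1 laurent_val).
rewrite !laurent_valM !laurent_valX !polyq_val !exprVn => /eqP.
have nz k : tofrac ('X : {poly int}) ^+ k != 0 by rewrite expf_neq0 ?fracX_neq0.
rewrite eqr_div // -!tofracXn -!tofracM tofrac_eq => /eqP.
move=> /(congr1 (fun p : {poly int} => (map_poly (intr : int -> B) p).[u])).
rewrite /= !rmorphM !rmorphXn /= !map_polyX !hornerM !hornerXn => e.
have uvn k : u ^+ k * v ^+ k = 1 by rewrite -exprMn uv expr1n.
rewrite -[LHS]mulr1 -[X in _ * X = _](uvn n) mulrACA -e.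
by rewrite -mulrA [u ^+ n' * _]mulrA uvn mul1r.
Qed.

Fact laurent_eval_zmod : zmod_morphism (laurent_eval uv).
Proof.
move=> a b; have [p [n ->]] := laurentP a; have [p' [n' ->]] := laurentP b.
have qn k : q ^+ k * qV ^+ k = 1 by rewrite -exprMn mulqV expr1n.
have uvn k : u ^+ k * v ^+ k = 1 by rewrite -exprMn uv expr1n.
have -> : polyq p * qV ^+ n - polyq p' * qV ^+ n'
   = polyq (p * 'X^n' - p' * 'X^n) * qV ^+ (n + n').
  rewrite /polyq rmorphB !rmorphM !rmorphXn /= !map_polyX hornerD hornerN.
  rewrite !hornerM !hornerXn exprD mulrBl.
  congr (_ - _); first by rewrite mulrACA qn mulr1.
  by rewrite [qV ^+ n * _]mulrC mulrACA qn mulr1.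
rewrite !laurent_evalE rmorphB !rmorphM !rmorphXn /= !map_polyX hornerD hornerN.
rewrite !hornerM !hornerXn exprD mulrBl.
congr (_ - _); first by rewrite mulrACA uvn mulr1.
by rewrite [v ^+ n * _]mulrC mulrACA uvn mulr1.
Qed.

Fact laurent_eval_monoid : monoid_morphism (laurent_eval uv).
Proof.
split=> [|a b].
  have -> : 1 = polyq 1 * qV ^+ 0.
    by rewrite /polyq rmorph1 hornerC mulr1.
  by rewrite laurent_evalE rmorph1 hornerC mulr1.
have [p [n ->]] := laurentP a; have [p' [n' ->]] := laurentP b.
have -> : polyq p * qV ^+ n * (polyq p' * qV ^+ n')
   = polyq (p * p') * qV ^+ (n + n').
  by rewrite mulrACA exprD /polyq rmorphM hornerM.
by rewrite !laurent_evalE rmorphM hornerM exprD mulrACA.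
Qed.

HB.instance Definition _ := GRing.isZmodMorphism.Build laurent B
  (laurent_eval uv) laurent_eval_zmod.
HB.instance Definition _ := GRing.isMonoidMorphism.Build laurent B
  (laurent_eval uv) laurent_eval_monoid.

Lemma laurent_eval_q : laurent_eval uv q = u.
Proof.
have -> : q = polyq 'X * qV ^+ 0 by rewrite /polyq map_polyX hornerX mulr1.
by rewrite laurent_evalE map_polyX hornerX mulr1.
Qed.

Lemma laurent_eval_qV : laurent_eval uv qV = v.
Proof.
have -> : qV = polyq 1 * qV ^+ 1 by rewrite /polyq rmorph1 hornerC mul1r.
by rewrite laurent_evalE rmorph1 hornerC mul1r.
Qed.

End LaurentEval.

Fact mulVq : qV * q = 1. Proof. by rewrite mulrC mulqV. Qed.

Definition abar : {rmorphism laurent -> laurent} := laurent_eval mulVq.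

Lemma abar_q : abar q = qV. Proof. exact: laurent_eval_q. Qed.
Lemma abar_qV : abar qV = q. Proof. exact: laurent_eval_qV. Qed.
Lemma abar_xi : abar xi = - xi.
Proof. by rewrite /xi rmorphB /= abar_q abar_qV opprB. Qed.
Lemma abarK : involutive abar.
Proof.
move=> a; have [p [n ->]] := laurentP a.
rewrite !rmorphM !rmorphXn /= abar_qV abar_q; congr (_ * _).
elim/poly_ind: p => [|p c IHp]; first by rewrite /polyq rmorph0 horner0 !rmorph0.
rewrite /polyq rmorphD rmorphM /= map_polyX map_polyC !hornerE /=.
by rewrite -/(polyq p) !rmorphD !rmorphM /= IHp abar_q abar_qV !rmorph_int.
Qed.

(* The product x y x ... of k factors that begins with x. *)
Fixpoint braid_word (B : nzRingType) (x y : B) (k : nat) : B :=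
  if k is k'.+1 then x * braid_word y x k' else 1.

(* [..xy]_k *)
Definition alt_word (W : finGroupType) (x y : W) (k : nat) : W :=
  (if odd k then y * (x * y) ^+ k./2 else (x * y) ^+ k./2)%g.

(* The Hecke algebra of (W, S): the A-algebra presented by generators T_r,    *)
(* r in S, is built as the quotient of the set of formal expressions by the   *)
(* congruence generated by the axioms of A-algebras and the Hecke relations.  *)

Section Hecke.
Variables (W : finGroupType) (S : {set W}).

Inductive hterm : Type :=
| HGen of {r : W | r \in S}
| HCst of laurent
| HAdd of hterm & hterm
| HMul of hterm & hterm.

Fixpoint hword (x y : hterm) (k : nat) : hterm :=
  if k is k'.+1 then HMul x (hword y x k') else HCst 1.

Inductive heq : hterm -> hterm -> Prop :=
| heq_refl x : heq x x
| heq_sym x y : heq x y -> heq y x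
| heq_trans x y z : heq x y -> heq y z -> heq x z
| heq_add x x' y y' : heq x x' -> heq y y' -> heq (HAdd x y) (HAdd x' y')
| heq_mul x x' y y' : heq x x' -> heq y y' -> heq (HMul x y) (HMul x' y')
| heq_addA x y z : heq (HAdd x (HAdd y z)) (HAdd (HAdd x y) z)
| heq_addC x y : heq (HAdd x y) (HAdd y x)
| heq_add0 x : heq (HAdd (HCst 0) x) x
| heq_addN x : heq (HAdd (HMul (HCst (-1)) x) x) (HCst 0)
| heq_mulA x y z : heq (HMul x (HMul y z)) (HMul (HMul x y) z)
| heq_mul1 x : heq (HMul (HCst 1) x) x
| heq_mulDl x y z : heq (HMul (HAdd x y) z) (HAdd (HMul x z) (HMul y z))
| heq_mulDr x y z : heq (HMul x (HAdd y z)) (HAdd (HMul x y) (HMul x z))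
| heq_cstD a b : heq (HCst (a + b)) (HAdd (HCst a) (HCst b))
| heq_cstM a b : heq (HCst (a * b)) (HMul (HCst a) (HCst b))
| heq_cstC a x : heq (HMul (HCst a) x) (HMul x (HCst a))
| heq_quad r : heq (HMul (HGen r) (HGen r))
                   (HAdd (HCst 1) (HMul (HCst xi) (HGen r)))
| heq_braid r r' : heq (hword (HGen r) (HGen r') #[(val r * val r')%g]%g)
                       (hword (HGen r') (HGen r) #[(val r * val r')%g]%g).

HB.instance Definition _ := gen_eqMixin hterm.
HB.instance Definition _ := gen_choiceMixin hterm.

Definition heqb (x y : hterm) : bool := `[< heq x y >].

Fact heqb_refl : reflexive heqb.
Proof. by move=> x; apply/asboolP; apply: heq_refl. Qed.
Fact heqb_sym : symmetric heqb.
Proof.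
by move=> x y; apply/asboolP/asboolP; apply: heq_sym.
Qed.
Fact heqb_trans : transitive heqb.
Proof.
move=> y x z /asboolP xy /asboolP yz; apply/asboolP.
exact: heq_trans xy yz.
Qed.

Canonical heqb_equiv := EquivRel heqb heqb_refl heqb_sym heqb_trans.

Definition hecke : Type := {eq_quot heqb}.
HB.instance Definition _ : EqQuotient _ heqb hecke := EqQuotient.on hecke.
HB.instance Definition _ := Choice.on hecke.

Definition hpi (x : hterm) : hecke := \pi_hecke x.

Lemma hpiP x y : hpi x = hpi y <-> heq x y.
Proof.
split=> [/eqP|h]; first by rewrite /hpi eqmodE => /asboolP.
by apply/eqP; rewrite /hpi eqmodE; apply/asboolP.
Qed.

Lemma hpi_repr (h : hecke) : hpi (repr h) = h.
Proof. exact: reprK. Qed.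

Definition hcst (a : laurent) : hecke := hpi (HCst a).
Definition hadd (g h : hecke) : hecke := hpi (HAdd (repr g) (repr h)).
Definition hmul (g h : hecke) : hecke := hpi (HMul (repr g) (repr h)).
Definition hopp (h : hecke) : hecke := hmul (hcst (-1)) h.

Lemma hpi_add x y : hpi (HAdd x y) = hadd (hpi x) (hpi y).
Proof. by apply/hpiP; apply: heq_add; apply/hpiP; rewrite hpi_repr. Qed.
Lemma hpi_mul x y : hpi (HMul x y) = hmul (hpi x) (hpi y).
Proof. by apply/hpiP; apply: heq_mul; apply/hpiP; rewrite hpi_repr. Qed.

Lemma hpi_surj (h : hecke) : exists x, h = hpi x.
Proof. by exists (repr h); rewrite hpi_repr. Qed.

Fact haddA : associative hadd.
Proof.
move=> f g h; rewrite -(hpi_repr f) -(hpi_repr g) -(hpi_repr h) -!hpi_add.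
by apply/hpiP; apply: heq_addA.
Qed.
Fact haddC : commutative hadd.
Proof.
move=> f g; rewrite -(hpi_repr f) -(hpi_repr g) -!hpi_add.
by apply/hpiP; apply: heq_addC.
Qed.
Fact hadd0 : left_id (hcst 0) hadd.
Proof.
by move=> f; rewrite -(hpi_repr f) -!hpi_add; apply/hpiP; apply: heq_add0.
Qed.
Fact haddN : left_inverse (hcst 0) hopp hadd.
Proof.
move=> f; rewrite -(hpi_repr f) /hopp -hpi_mul -!hpi_add.
by apply/hpiP; apply: heq_addN.
Qed.

HB.instance Definition _ :=
  GRing.isZmodule.Build hecke haddA haddC hadd0 haddN.

Fact hmulA : associative hmul.
Proof.
move=> f g h; rewrite -(hpi_repr f) -(hpi_repr g) -(hpi_repr h) -!hpi_mul.
by apply/hpiP; apply: heq_mulA.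
Qed.
Fact hcstC a h : hmul (hcst a) h = hmul h (hcst a).
Proof.
by rewrite -(hpi_repr h) -!hpi_mul; apply/hpiP; apply: heq_cstC.
Qed.
Fact hmul1 : left_id (hcst 1) hmul.
Proof.
by move=> f; rewrite -(hpi_repr f) -!hpi_mul; apply/hpiP; apply: heq_mul1.
Qed.
Fact hmul1r : right_id (hcst 1) hmul.
Proof. by move=> f; rewrite -hcstC hmul1. Qed.
Fact hmulDl : left_distributive hmul hadd.
Proof.
move=> f g h; rewrite -(hpi_repr f) -(hpi_repr g) -(hpi_repr h).
by rewrite -!(hpi_add, hpi_mul); apply/hpiP; apply: heq_mulDl.
Qed.
Fact hmulDr : right_distributive hmul hadd.
Proof.
move=> f g h; rewrite -(hpi_repr f) -(hpi_repr g) -(hpi_repr h).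
by rewrite -!(hpi_add, hpi_mul); apply/hpiP; apply: heq_mulDr.
Qed.

Section TermEval.
Variables (B : nzRingType) (c : {rmorphism laurent -> B}).
Variable f : {r : W | r \in S} -> B.

Fixpoint term_eval (x : hterm) : B :=
  match x with
  | HGen r => f r
  | HCst a => c a
  | HAdd x y => term_eval x + term_eval y
  | HMul x y => term_eval x * term_eval y
  end.

Lemma term_eval_word x y k :
  term_eval (hword x y k) = braid_word (term_eval x) (term_eval y) k.
Proof. by elim: k x y => [|k IHk] x y /=; rewrite ?rmorph1 ?IHk. Qed.

Definition hecke_rel : Prop :=
  [/\ forall a r, c a * f r = f r * c a,
      forall r, f r * f r = 1 + c xi * f r
    & forall r r', let m := #[(val r * val r')%g]%g in
        braid_word (f r) (f r') m = braid_word (f r') (f r) m].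

Lemma term_eval_heq x y : hecke_rel -> heq x y -> term_eval x = term_eval y.
Proof.
case=> cf quad braid; elim=> {x y} //=.
- by move=> x y z _ -> _ ->.
- by move=> x x' y y' _ -> _ ->.
- by move=> x x' y y' _ -> _ ->.
- by move=> x y z; rewrite addrA.
- by move=> x y; rewrite addrC.
- by move=> x; rewrite rmorph0 add0r.
- by move=> x; rewrite rmorphN1 mulN1r addNr rmorph0.
- by move=> x y z; rewrite mulrA.
- by move=> x; rewrite rmorph1 mul1r.
- by move=> x y z; rewrite mulrDl.
- by move=> x y z; rewrite mulrDr.
- by move=> a b; rewrite rmorphD.
- by move=> a b; rewrite rmorphM.
- move=> a; elim=> [r|b|x IHx y IHy|x IHx y IHy] /=.
  + exact: cf.
  + by rewrite -!rmorphM mulrC.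
  + by rewrite mulrDr IHx IHy mulrDl.
  + by rewrite mulrA IHx -mulrA IHy mulrA.
- by move=> r; rewrite rmorph1 quad.
- by move=> r r'; rewrite !term_eval_word; apply: braid.
Qed.

Definition hecke_eval (h : hecke) : B := term_eval (repr h).

Lemma hecke_eval_hpi x : hecke_rel -> hecke_eval (hpi x) = term_eval x.
Proof. by move=> cf; apply: term_eval_heq => //; apply/hpiP; rewrite hpi_repr. Qed.

End TermEval.

Fact hone_neq0 : hcst 1 != 0.
Proof.
apply/eqP => /(congr1 (@hecke_eval laurent idfun (fun _ => q))).
have rel : @hecke_rel laurent idfun (fun _ => q).
  split=> [a _|_|//]; first by rewrite mulrC.
  by rewrite /= /xi mulrBl mulVq addrC subrK.
by rewrite !hecke_eval_hpi //= => /eqP; rewrite oner_eq0.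
Qed.

HB.instance Definition _ := GRing.Zmodule_isNzRing.Build hecke
  hmulA hmul1 hmul1r hmulDl hmulDr hone_neq0.

Definition hscale (a : laurent) (h : hecke) : hecke := hcst a * h.

Lemma hcstM a b : hcst (a * b) = hcst a * hcst b.
Proof. by rewrite -[RHS]hpi_mul; apply/hpiP; apply: heq_cstM. Qed.
Lemma hcstD a b : hcst (a + b) = hcst a + hcst b.
Proof. by rewrite -[RHS]hpi_add; apply/hpiP; apply: heq_cstD. Qed.

Fact hscaleA a b h : hscale a (hscale b h) = hscale (a * b) h.
Proof. by rewrite /hscale hcstM mulrA. Qed.
Fact hscale1 : left_id 1 hscale.
Proof. by move=> h; rewrite /hscale [LHS]hmul1. Qed.
Fact hscaleDr : right_distributive hscale +%R.
Proof. by move=> a g h; rewrite /hscale mulrDr. Qed.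
Fact hscaleDl h : {morph hscale^~ h : a b / a + b}.
Proof. by move=> a b; rewrite /hscale hcstD mulrDl. Qed.

HB.instance Definition _ := GRing.Zmodule_isLmodule.Build laurent hecke
  hscaleA hscale1 hscaleDr hscaleDl.

Fact hscaleAl a (g h : hecke) : a *: (g * h) = (a *: g) * h.
Proof. exact: mulrA. Qed.
HB.instance Definition _ := GRing.Lmodule_isLalgebra.Build laurent hecke hscaleAl.

Fact hscaleAr a (g h : hecke) : a *: (g * h) = g * (a *: h).
Proof.
rewrite -[LHS]/(hcst a * (g * h)) -[a *: h]/(hcst a * h) !mulrA.
by congr (_ * _); apply: hcstC.
Qed.
HB.instance Definition _ := GRing.Lalgebra_isAlgebra.Build laurent hecke hscaleAr.

Definition T (r : {r : W | r \in S}) : hecke := hpi (HGen r).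

Lemma hcstE a : hcst a = a%:A.
Proof. by rewrite -[RHS]/(hcst a * 1) mulr1. Qed.

Lemma hpi_word x y k : hpi (hword x y k) = braid_word (hpi x) (hpi y) k.
Proof. by elim: k x y => [|k IHk] x y //=; rewrite hpi_mul IHk. Qed.

Lemma T_quad r : T r * T r = 1 + xi *: T r.
Proof.
rewrite -[LHS]hpi_mul -[xi *: _]hpi_mul -[RHS]hpi_add.
by apply/hpiP; apply: heq_quad.
Qed.

Lemma T_braid r r' : let m := #[(val r * val r')%g]%g in
  braid_word (T r) (T r') m = braid_word (T r') (T r) m.
Proof. by rewrite /= -!hpi_word; apply/hpiP; apply: heq_braid. Qed.

Lemma hecke_ind (P : hecke -> Prop) :
  (forall r, P (T r)) -> (forall a, P a%:A) ->
  (forall g h, P g -> P h -> P (g + h)) ->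
  (forall g h, P g -> P h -> P (g * h)) -> forall h, P h.
Proof.
move=> PT Pc PD PM h; rewrite -(hpi_repr h).
elim: (repr h) => [r|a|x Px y Py|x Px y Py]; first exact: PT.
- by rewrite -[hpi _]/(hcst a) hcstE.
- by rewrite hpi_add; apply: PD.
- by rewrite hpi_mul; apply: PM.
Qed.

Section Eval.
Variables (B : nzRingType) (c : {rmorphism laurent -> B}).
Variables (f : {r : W | r \in S} -> B) (rel : hecke_rel c f).
Let ev := hecke_eval c f.

Lemma hecke_evalT r : ev (T r) = f r.
Proof. by rewrite /ev hecke_eval_hpi. Qed.
Lemma hecke_evalC a : ev a%:A = c a.
Proof. by rewrite -hcstE /ev hecke_eval_hpi. Qed.
Lemma hecke_evalM : {morph ev : g h / g * h}.
Proof.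
move=> g h; rewrite -(hpi_repr g) -(hpi_repr h) -[_ * _]hpi_mul.
by rewrite /ev !hecke_eval_hpi.
Qed.
Lemma hecke_evalD : {morph ev : g h / g + h}.
Proof.
move=> g h; rewrite -(hpi_repr g) -(hpi_repr h) -[_ + _]hpi_add.
by rewrite /ev !hecke_eval_hpi.
Qed.
End Eval.

(* The bar involution, sending T_r to T_r^-1 = T_r - (q - q^-1). *)
Definition TV (r : {r : W | r \in S}) : hecke := T r - xi%:A.

Lemma mulTV r : T r * TV r = 1.
Proof. by rewrite /TV mulrBr T_quad -scalerAr mulr1 addrK. Qed.
Lemma mulVT r : TV r * T r = 1.
Proof. by rewrite /TV mulrBl T_quad -scalerAl mul1r addrK. Qed.

Lemma braid_wordSr (B : nzRingType) (x y : B) k :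
  braid_word x y k.+1 = braid_word x y k * (if odd k then y else x).
Proof.
elim: k x y => [|k IHk] x y; first by rewrite /= mul1r mulr1.
by rewrite -[LHS]/(x * braid_word y x k.+1) IHk mulrA /=; case: (odd k).
Qed.

Lemma braid_wordV (B : nzRingType) (x y x' y' : B) k :
    x * x' = 1 -> x' * x = 1 -> y * y' = 1 -> y' * y = 1 ->
  let w := if odd k then braid_word x y k else braid_word y x k in
  braid_word x' y' k * w = 1 /\ w * braid_word x' y' k = 1.
Proof.
move=> xx' x'x yy' y'y.
elim: k x y x' y' xx' x'x yy' y'y => [|k IHk] x y x' y' xx' x'x yy' y'y.
  by rewrite /= mulr1.
have [] := IHk y x y' x' yy' y'y xx' x'x.
rewrite -[braid_word x' y' k.+1]/(x' * braid_word y' x' k) !braid_wordSr /=.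
case: (odd k) => /= h1 h2.
  split; last by rewrite -mulrA [x * _]mulrA xx' mul1r.
  by rewrite mulrA -[x' * _ * _]mulrA h1 mulr1.
split; last by rewrite -mulrA [x * _]mulrA xx' mul1r.
by rewrite mulrA -[x' * _ * _]mulrA h1 mulr1.
Qed.

Definition abar_alg : {rmorphism laurent -> hecke} := in_alg hecke \o abar.

Lemma abar_algE a : abar_alg a = (abar a)%:A.
Proof. by []. Qed.

Fact hbar_rel : hecke_rel abar_alg TV.
Proof.
split=> [a r|r|r r' m].
- by rewrite abar_algE -scalerAl -scalerAr mul1r mulr1.
- rewrite abar_algE abar_xi {2}/TV mulrBr mulVT -scalerAr mulr1.
  by rewrite -scalerAl mul1r scaleNr.
- have [h1 h2] := braid_wordV m (mulTV r) (mulVT r) (mulTV r') (mulVT r').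
  have [h3 h4] := braid_wordV m (mulTV r') (mulVT r') (mulTV r) (mulVT r).
  move: h1 h2 h3 h4; rewrite -(T_braid r r') -/m if_same => h1 h2 h3 h4.
  by rewrite -[LHS]mulr1 -h4 mulrA h1 mul1r.
Qed.

Definition hbar : hecke -> hecke := hecke_eval abar_alg TV.

Lemma hbarT r : hbar (T r) = TV r.
Proof. exact: (hecke_evalT hbar_rel). Qed.
Lemma hbarD : {morph hbar : g h / g + h}.
Proof. exact: (hecke_evalD hbar_rel). Qed.
Lemma hbarM : {morph hbar : g h / g * h}.
Proof. exact: (hecke_evalM hbar_rel). Qed.
Lemma hbarC a : hbar a%:A = (abar a)%:A.
Proof. exact: (hecke_evalC hbar_rel). Qed.
Lemma hbarZ a h : hbar (a *: h) = abar a *: hbar h.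
Proof. by rewrite -mulr_algl hbarM hbarC mulr_algl. Qed.
Lemma hbarK : involutive hbar.
Proof.
elim/hecke_ind => [r|a|g h Hg Hh|g h Hg Hh].
- rewrite hbarT /TV hbarD hbarT -scaleNr hbarC rmorphN abar_xi opprK.
  by rewrite /TV subrK.
- by rewrite !hbarC [X in X%:A]abarK.
- by rewrite !hbarD Hg Hh.
- by rewrite !hbarM Hg Hh.
Qed.

End Hecke.

Section Coxeter.
Variables (W : finGroupType) (S : {set W}).
Local Open Scope group_scope.
Implicit Types (u v w : W) (I J : {set W}).

(* The least k such that w is a product of k elements of S; the default value *)
(* 0 is never used when S generates W.                                        *)
Definition len w : nat :=
  if pselect (exists k, w \in S ^+ k) is left e then ex_minn e else 0%N.

Definition reflections : {set W} := class_support S [set: W].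

Definition bruhat_le u v : bool :=
  connect [rel x y | (y * x^-1 \in reflections) && (len x < len y)%N] u v.
Definition bruhat_lt u v : bool := (u != v) && bruhat_le u v.

Definition weak_le v w : bool := len w == (len (w * v^-1) + len v)%N.

Definition weak_ideal I : Prop :=
  I != set0 /\ forall v w, weak_le v w -> w \in I -> v \in I.

Definition D J : {set W} := [set w | [forall r in J, (len w < len (w * r))%N]].

Definition SD w : {set W} := [set r in S | bruhat_lt (r * w) w].
Definition SA I w : {set W} :=
  [set r in S | bruhat_lt w (r * w) & r * w \in I].
Definition WD J w : {set W} :=
  [set r in S | bruhat_lt w (r * w) & r * w \notin D J].
Definition WA I J w : {set W} :=
  [set r in S | bruhat_lt w (r * w) & r * w \in D J :\: I].

End Coxeter.

(* The presentation W = < s, t | s^2 = t^2 = (st)^m = 1 >: generation, the    *)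
(* relations, and the universal property among all groups.                    *)
Definition coxeter_I2 (m : nat) (W : finGroupType) (s t : W) : Prop :=
  [/\ <<[set s; t]>> = [set: W], s ^+ 2 = 1, t ^+ 2 = 1, (s * t) ^+ m = 1
    & forall (G : groupType) (x y : G),
        x ^+ 2 = 1 -> y ^+ 2 = 1 -> (x * y) ^+ m = 1 ->
      exists f : W -> G,
        [/\ {morph f : a b / a * b >-> a * b}, f s = x & f t = y]]%g.

(* A left H-module M is an A-module through A -> H; the      *)
(* product of a in A and x in M is thus written a%:A *: x.                    *)

Section WGraphIdeal.
Variables (W : finGroupType) (S : {set W}).
Local Notation H := (hecke S).

(* The values of b and of the coefficient functions outside I are irrelevant. *)
Definition A_basis (M : lmodType H) (I : {set W}) (b : W -> M) : Prop :=
  (forall x : M, exists c : W -> laurent,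
     x = \sum_(w in I) ((c w)%:A : H) *: b w) /\
  (forall c : W -> laurent, \sum_(w in I) ((c w)%:A : H) *: b w = 0 ->
     forall w, w \in I -> c w = 0).

Definition wgraph_action (M : lmodType H) (I J : {set W}) (b : W -> M) : Prop :=
  forall (r : {r : W | r \in S}) (w : W), w \in I ->
  [/\ val r \in SA S I w -> T r *: b w = b (val r * w)%g,
      val r \in SD S w ->
        T r *: b w = b (val r * w)%g + ((q - qV)%:A : H) *: b w,
      val r \in WD S J w -> T r *: b w = ((- qV)%:A : H) *: b w
    & val r \in WA S I J w ->
        exists p : W -> {poly int},
          T r *: b w = (q%:A : H) *: b w
            - \sum_(y in I | bruhat_lt S y (val r * w)%g)
                ((q * polyq (p y))%:A : H) *: b y].

Definition wgraph_bar (M : lmodType H) (b : W -> M) (bar : M -> M) : Prop :=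
  [/\ {morph bar : x y / x + y},
      forall (a : laurent) (x : M),
        bar ((a%:A : H) *: x) = ((abar a)%:A : H) *: bar x,
      involutive bar,
      bar (b 1%g) = b 1%g
    & forall (h : H) (x : M), bar (h *: x) = hbar h *: bar x].

Definition wgraph_ideal (I J : {set W}) : Prop :=
  [/\ weak_ideal S I, I \subset D S J
    & exists (M : lmodType H) (b : W -> M),
        [/\ A_basis I b, wgraph_action I J b & exists bar, wgraph_bar b bar]].

End WGraphIdeal.

(* Main.v *)
Require Import Defs.
From HB Require Import structures.
From mathcomp Require Import all_boot all_fingroup.
From mathcomp Require Import all_order all_algebra cyclic boolp zify.

Set Implicit Arguments.
Unset Strict Implicit.
Unset Printing Implicit Defensive.

(** A left ideal I of the dihedral group W consists of the alternating words
    [aword b l] with l <= h b, where b names the last letter; so the data are two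
    heights. The case where J has two elements is trivial.

    The core of the proof is a sequence of vectors. Put C_r = T_r - q. If z is an
    eigenvector of one generator for -q^-1, the recursion
    P (n + 2) = C_r (P (n + 1)) - P n with alternating letters r, P 0 = 0 and
    P 1 = z ([path_seq]) gives the vertices of a W-graph of type A that is a
    half-line. The words T_w z and the vertices differ by a unitriangular change
    of basis with coefficients in q Z[q], and P is fixed by bar if z is. If
    moreover P N = 0, reflections fold P onto P 1, ..., P (N - 1)
    ([path_folding]): P n vanishes if N divides n, and it is P i or - P i for
    some 0 < i < N otherwise. When J has one element, z is the vector b_1; when J
    is empty, b_1 emits two paths, starting at C_s b_1 and C_t b_1 ([side_seq]).

    Suppose that (I, J) is a W-graph ideal with I different from D_J. In the given
    module, the formula for weak ascents shows that the path is in q times the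
    Z[q]-span of the b_w at the first index N where it has left I, and a
    bar-invariant vector of that kind is zero ([bar_fixed_eq0]). Hence P N = 0
    with N = k + 2 when J has one element, and N = h + 1 or k + 1 for the two
    paths when J is empty ([model_path_top], [model_side]). The braid relation
    applied to b_1 makes both generators act on P m by -q^-1. No P i with
    0 < i < N has this property ([path_double_descent]), so P m = 0 and N divides
    m.

    Conversely, take the W-graph with vertex set I and edges given by left
    multiplication ([wg_image]). Its matrices satisfy the quadratic relations and
    the compatibility with bar for formal reasons. The kernel of the difference
    of the two sides of the braid relation is a submodule ([braid_stable]), so
    that the braid relation has to be checked on the vertex 1 alone, which
    generates the module; there it holds because P m = 0 by folding, or, when
    I = D_J, because the path ends in a vertex with two descents. The words
    applied to the vertex 1 then form the required basis ([wgraph_of_words]). *)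

(** * Lattices over Z[q], triangularity and bar-invariant vectors *)
Section Lattices.
Import GRing.Theory.
Local Open Scope ring_scope.

Definition in_Zq (a : laurent) : Prop := exists p, a = polyq p.

Lemma polyqD p p' : polyq (p + p') = polyq p + polyq p'.
Proof. by rewrite /polyq rmorphD hornerD. Qed.
Lemma polyqM p p' : polyq (p * p') = polyq p * polyq p'.
Proof. by rewrite /polyq rmorphM hornerM. Qed.
Lemma polyqX : polyq 'X = q.
Proof. by rewrite /polyq map_polyX hornerX. Qed.
Lemma polyqC c : polyq c%:P = c%:~R.
Proof. by rewrite /polyq map_polyC hornerC. Qed.

Lemma polyq_inj : injective polyq.
Proof.
move=> p p' /(congr1 laurent_val); rewrite !polyq_val => /eqP.
by rewrite tofrac_eq => /eqP.
Qed.

(** The left side lies in q^-1 Z[q^-1] and the right side in q Z[q], so both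
    vanish. Multiplying by a power of q turns this into a comparison of
    degrees between two polynomials, one of them the reversal r of p. *)
Lemma abar_fixed_eq0 p : abar (q * polyq p) = q * polyq p -> polyq p = 0.
Proof.
pose n := size p; pose r : {poly int} := \sum_(i < n) p`_i *: 'X^(n - i).
have qn k : q ^+ k * qV ^+ k = 1 by rewrite -exprMn mulqV expr1n.
have rE : q ^+ n * abar (polyq p) = polyq r.
  rewrite -[in LHS](coefK p) poly_def /polyq !rmorph_sum !horner_sum.
  rewrite rmorph_sum mulr_sumr; apply: eq_bigr => i _.
  rewrite /= !linearZ /= !map_polyXn !hornerZ !hornerXn rmorphM rmorphXn /=.
  rewrite abar_q rmorph_int mulrCA; congr (_ * _).
  have -> : q ^+ n = q ^+ (n - i) * q ^+ i.
    by rewrite -exprD subnK // ltnW.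
  by rewrite -mulrA qn mulr1.
rewrite rmorphM abar_q => /(congr1 ( *%R (q ^+ n.+1))).
rewrite {1}exprSr -[LHS]mulrA [q * (qV * _)]mulrA mulqV mul1r rE.
rewrite mulrA -exprSr.
have -> k : q ^+ k = polyq 'X^k.
  by rewrite /polyq map_polyXn hornerXn.
rewrite -polyqM => /polyq_inj e.
have [->|p0] := eqVneq p 0; first by rewrite -[0 in LHS]/(0%:P) polyqC.
have : (size r <= n.+1)%N.
  apply: (leq_trans (size_sum _ _ _)); apply/bigmax_leqP => i _.
  apply: (leq_trans (size_scale_leq _ _)); rewrite size_polyXn.
  by rewrite ltnS leq_subr.
rewrite e mulrC size_mulXn // -/n.
by have := size_poly_gt0 p; rewrite p0 -/n; lia.
Qed.

Variables (W : finType) (I : {set W}) (ht : W -> nat) (V : lmodType laurent).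
Implicit Types (v : W -> V) (K : laurent -> Prop).

Definition is_basis v : Prop :=
  (forall x, exists c, x = \sum_(w in I) c w *: v w) /\
  (forall c, \sum_(w in I) c w *: v w = 0 -> forall w, w \in I -> c w = 0).

(** The coefficients range over a set K, to be taken equal to Z[q] or to the
    whole of A, so that the lattice and the module spanned by the same vectors
    share one theory; the bound l on ht gives the filtration by length. *)
Definition cspan K v (l : nat) (x : V) : Prop := exists c : W -> laurent,
  (forall w, K (c w)) /\ x = \sum_(w in I | (ht w < l)%N) c w *: v w.

Definition semiring_pred K := [/\ K 0, K 1,
  (forall a b, K a -> K b -> K (a + b)) & (forall a b, K a -> K b -> K (a * b))].

Lemma semiring_Zq : semiring_pred in_Zq.
Proof.
split=> [||_ _ [p ->] [p' ->]|_ _ [p ->] [p' ->]].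
- by exists 0; rewrite -[0 in RHS]/(0%:P) polyqC.
- by exists 1; rewrite -[1 in RHS]/(1%:P) polyqC.
- by exists (p + p'); rewrite polyqD.
- by exists (p * p'); rewrite polyqM.
Qed.

Lemma q_Zq : in_Zq q. Proof. by exists 'X; rewrite polyqX. Qed.
Lemma in_ZqN a : in_Zq a -> in_Zq (- a).
Proof. by case=> p ->; exists ((-1)%:P * p); rewrite polyqM polyqC mulN1r. Qed.
Lemma intr_Zq c : in_Zq c%:~R. Proof. by exists c%:P; rewrite polyqC. Qed.

Lemma semiring_true : semiring_pred (fun _ => True). Proof. by []. Qed.

Section Span.
Variables (K : laurent -> Prop) (HK : semiring_pred K).

Lemma cspan0 v l : cspan K v l 0.
Proof.
have [K0 _ _ _] := HK; exists (fun _ => 0); split=> //.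
by rewrite big1 // => w _; rewrite scale0r.
Qed.

Lemma cspanD v l x y : cspan K v l x -> cspan K v l y -> cspan K v l (x + y).
Proof.
have [_ _ KD _] := HK; move=> [c [cK ->]] [d [dK ->]].
exists (fun w => c w + d w); split=> [w|]; first exact: KD.
by rewrite -big_split; apply: eq_bigr => w _; rewrite scalerDl.
Qed.

Lemma cspanZ v l a x : K a -> cspan K v l x -> cspan K v l (a *: x).
Proof.
have [_ _ _ KM] := HK; move=> Ka [c [cK ->]].
exists (fun w => a * c w); split=> [w|]; first exact: KM.
by rewrite scaler_sumr; apply: eq_bigr => w _; rewrite scalerA.
Qed.

Lemma cspan_sum v l (J : finType) (P : pred J) (F : J -> V) :
  (forall i, P i -> cspan K v l (F i)) -> cspan K v l (\sum_(i | P i) F i).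
Proof.
by move=> h; elim/big_rec: _ => [|i x Pi sx]; [apply: cspan0 | apply: cspanD; auto].
Qed.

Lemma cspan_mem v l w : w \in I -> (ht w < l)%N -> cspan K v l (v w).
Proof.
have [K0 K1 _ _] := HK; move=> wI wl; exists (fun u => (u == w)%:R); split.
  by move=> u; case: (u == w).
rewrite (bigD1 w) ?wI //= eqxx scale1r big1 ?addr0 // => u /andP[_ /negPf->].
by rewrite scale0r.
Qed.

Lemma cspan_trans v v' l l' x :
    (forall w, w \in I -> (ht w < l)%N -> cspan K v' l' (v w)) ->
  cspan K v l x -> cspan K v' l' x.
Proof.
move=> h [c [cK ->]]; apply: cspan_sum => w /andP[wI wl].
by apply: cspanZ => //; apply: h.
Qed.

Lemma cspan_mono v l l' x : (l <= l')%N -> cspan K v l x -> cspan K v l' x.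
Proof.
move=> ll'; apply: cspan_trans => w wI wl; apply: cspan_mem => //.
exact: leq_trans ll'.
Qed.

(** The relation is inverted by induction on the height: v w = v' w - q x, and
    x only involves vectors of smaller height. *)
Lemma cspan_triangular v v' : K q ->
    (forall w, w \in I -> exists2 x, cspan K v (ht w) x & v' w = v w + q *: x) ->
  K (-1) -> forall l x, cspan K v l x -> cspan K v' l x.
Proof.
move=> Kq tri Kn; suff h w : w \in I -> cspan K v' (ht w).+1 (v w).
  by move=> l x; apply: cspan_trans => w /h h' wl; apply: cspan_mono h'.
move: {2}(ht w).+1 (ltnSn (ht w)) => n; elim: n w => // n IH w wn wI.
have [x sx e] := tri w wI; have -> : v w = v' w + (-1) *: (q *: x).
  by rewrite e scaleN1r addrK.
apply: cspanD; first exact: cspan_mem.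
apply: cspanZ => //; apply: cspanZ => //; apply: cspan_trans sx => u uI uw.
by apply: (@cspan_mono _ (ht u).+1); [lia | apply: IH; lia].
Qed.

End Span.

Lemma cspan_weaken K v l x : cspan K v l x -> cspan (fun _ => True) v l x.
Proof. by case=> c [_ e]; exists c. Qed.

Section Coordinates.
Variables (v : W -> V) (kap : W -> V -> laurent).
Hypothesis kap_lin : forall w a x y, kap w (a *: x + y) = a * kap w x + kap w y.
Hypothesis kap_v : forall u w, u \in I -> w \in I -> kap w (v u) = (u == w)%:R.

Lemma kap0 w : kap w 0 = 0.
Proof. by have := kap_lin w (-1) 0 0; rewrite scaler0 addr0 mulN1r addNr. Qed.

Lemma kapD w x y : kap w (x + y) = kap w x + kap w y.
Proof. by have := kap_lin w 1 x y; rewrite scale1r mul1r. Qed.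

Lemma kapZ w a x : kap w (a *: x) = a * kap w x.
Proof. by have := kap_lin w a x 0; rewrite addr0 kap0 addr0. Qed.

Lemma kap_sum w (J : finType) (P : pred J) (F : J -> V) :
  kap w (\sum_(i | P i) F i) = \sum_(i | P i) kap w (F i).
Proof.
by apply: (big_morph _ (fun x y => kapD w x y)); apply: kap0.
Qed.

Lemma kap_comb w (P : pred W) (c : W -> laurent) : w \in I ->
  kap w (\sum_(u in I | P u) c u *: v u) = if P w then c w else 0.
Proof.
move=> wI; rewrite kap_sum; case: ifP => Pw.
  rewrite (bigD1 w) ?wI //= kapZ kap_v // eqxx mulr1 big1 ?addr0 //.
  by move=> u /andP[/andP[uI _] /negPf uw]; rewrite kapZ kap_v // uw mulr0.
rewrite big1 // => u /andP[uI Pu]; rewrite kapZ kap_v //.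
by case: eqVneq => [uw|]; [rewrite uw Pw in Pu | rewrite mulr0].
Qed.

Lemma kap_span0 K w l x : w \in I -> (l <= ht w)%N -> cspan K v l x -> kap w x = 0.
Proof. by move=> wI lw [c [_ ->]]; rewrite kap_comb // ltnNge lw. Qed.

(** For independence, look at a nonzero coefficient of maximal height: no other
    term of the combination can cancel it. *)
Lemma triangular_basis v' :
    (forall x, exists c, x = \sum_(w in I) c w *: v w) ->
    (forall w, w \in I -> exists2 x,
       cspan (fun _ => True) v (ht w) x & v' w = v w + q *: x) -> is_basis v'.
Proof.
move=> gen tri; split=> [x|c c0].
  pose L := (\max_(w in I) ht w).+1.
  have [] : cspan (fun _ => True) v' L x.
    apply: (@cspan_triangular _ semiring_true v) => //.
    have [d ->] := gen x; apply: (cspan_sum semiring_true) => w wI.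
    apply: (cspanZ semiring_true) => //; apply: (cspan_mem semiring_true) => //.
    by rewrite ltnS; apply: leq_bigmax_cond.
  move=> d [_ ->]; exists d; apply: eq_bigl => w.
  by apply: andb_idr => wI; rewrite ltnS; apply: leq_bigmax_cond.
move=> w wI; apply/eqP/negPn/negP => cw.
have wP : (w \in I) && (c w != 0) by rewrite wI.
have [u /andP[uI cu] umax] :=
  @arg_maxnP _ w (fun u => (u \in I) && (c u != 0)) ht wP.
have /eqP := congr1 (kap u) c0; rewrite kap0 kap_sum.
rewrite (bigD1 u) //= big1 ?addr0 => [|y /andP[yI yu]].
  have [x sx ->] := tri u uI.
  rewrite kapZ kapD kapZ kap_v // eqxx (kap_span0 uI (leqnn _) sx) mulr0 addr0.
  by rewrite mulr1 (negPf cu).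
have [->|cy] := eqVneq (c y) 0; first by rewrite scale0r kap0.
have [x sx ->] := tri y yI; rewrite kapZ kapD kapZ kap_v // (negPf yu) add0r.
by rewrite (kap_span0 uI _ sx) ?mulr0 //; apply: umax; rewrite yI cy.
Qed.

(** The uniqueness half of the Kazhdan-Lusztig argument. A coefficient c w of
    maximal height sees only itself under bar, so q (c w) is a fixed point of
    the bar involution of A in q Z[q], hence zero by [abar_fixed_eq0]; the
    induction on n descends through the heights from l. *)
Lemma bar_fixed_eq0 (bar : V -> V) :
    {morph bar : x y / x + y} ->
    (forall a x, bar (a *: x) = abar a *: bar x) ->
    (forall w, w \in I -> exists2 x,
       cspan (fun _ => True) v (ht w) x & bar (v w) = v w + x) ->
  forall l x, cspan in_Zq v l x -> bar (q *: x) = q *: x -> x = 0.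
Proof.
move=> barD barZ tri l x [c [cZ xE]] bx.
have bar0 : bar 0 = 0 by have := barZ 0 0; rewrite scale0r rmorph0 scale0r.
suff c0 n w : w \in I -> (ht w < l)%N -> (l <= n + ht w)%N -> c w = 0.
  rewrite xE big1 // => w /andP[wI wl].
  by rewrite (c0 l w) ?scale0r // leq_addr.
elim: n w => [|n IH] w wI wl ln; first by rewrite leqNgt wl in ln.
have := congr1 (kap w) bx; rewrite kapZ xE kap_comb // wl scaler_sumr.
rewrite (big_morph bar barD bar0) kap_sum.
rewrite (bigD1 w) ?wI //= big1 ?addr0 => [|u /andP[/andP[uI ul] uw]].
  have [y sy e] := tri w wI.
  rewrite scalerA barZ e kapZ kapD kap_v // eqxx (kap_span0 wI (leqnn _) sy).
  by rewrite addr0 mulr1; have [p ->] := cZ w; apply: abar_fixed_eq0.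
have [hu|hu] := leqP (ht u) (ht w); last first.
  by rewrite (IH u) ?scale0r ?scaler0 ?bar0 ?kap0 //; lia.
have [y sy e] := tri u uI.
rewrite scalerA barZ e kapZ kapD kap_v // (negPf uw) (kap_span0 wI hu sy).
by rewrite addr0 mulr0.
Qed.

End Coordinates.

Lemma basis_coordinates v : is_basis v -> exists kap : W -> V -> laurent,
  (forall w a x y, kap w (a *: x + y) = a * kap w x + kap w y) /\
  (forall u w, u \in I -> w \in I -> kap w (v u) = (u == w)%:R).
Proof.
case=> gen free; have [f fE] := choice gen.
have uniq x c w : w \in I -> x = \sum_(w in I) c w *: v w -> f x w = c w.
  move=> wI xE; apply/eqP; rewrite -subr_eq0; apply/eqP.
  apply: (free (fun w => f x w - c w)) => //.
  under eq_bigr => u _ do rewrite scalerBl.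
  by rewrite sumrB -fE -xE subrr.
(* Off I the coordinate is set to 0, so that linearity holds for every w. *)
exists (fun w x => if w \in I then f x w else 0); split=> [w a x y|u w uI wI].
  case: ifP => wI; last by rewrite mulr0 addr0.
  apply: (uniq _ (fun w => a * f x w + f y w)) => //.
  rewrite [in LHS](fE x) [in LHS](fE y) scaler_sumr -big_split.
  by apply: eq_bigr => u _; rewrite scalerDl scalerA.
rewrite wI; apply: (uniq _ (fun w => (u == w)%:R)) => //.
rewrite (bigD1 u) //= eqxx scale1r big1 ?addr0 // => y /andP[_ yu].
by rewrite eq_sym (negPf yu) scale0r.
Qed.

End Lattices.

(** * Two quadratic operators and the paths they generate *)
Lemma q_plus_qV_neq0 : (q + qV != 0)%R.
Proof.
apply/eqP => /(congr1 (laurent_eval (GRing.mulr1 (1%R : int)))).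
by rewrite GRing.rmorphD /= laurent_eval_q laurent_eval_qV GRing.rmorph0.
Qed.

Section TwoOperators.
Import GRing.Theory.
Local Open Scope ring_scope.

Variables (V : lmodType laurent) (U : bool -> {linear V -> V}).
Hypothesis quad : forall b x, U b (U b x) = x + xi *: U b x.

(** The product of n alternating operators; b is the one applied first, that is,
    the last letter of the word. *)
Fixpoint opword (b : bool) (n : nat) (x : V) : V :=
  if n is k.+1 then U (b (+) odd k) (opword b k x) else x.

(** T_b - q. It commutes with the bar involution, as the bar conjugate of T_b is
    T_b - (q - q^-1), and its image lies in the eigenspace of T_b for -q^-1. *)
Definition klop (b : bool) (x : V) : V := U b x - q *: x.

(** A Chebyshev recursion. When z is an eigenvector of the other operator for
    the eigenvalue -q^-1, these vectors behave as the vertices of a W-graph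
    which is a half-line with end point z: for r = b (+) odd n, C_r carries the
    vertex n.+1 to the sum of its two neighbours, and the other letter is a
    descent of it. The value 0 before z makes the recursion uniform. *)
Fixpoint path_seq (b : bool) (z : V) (n : nat) : V :=
  match n with
  | 0 => 0
  | 1 => z
  | (k.+1 as k').+1 => klop (b (+) odd k) (path_seq b z k') - path_seq b z k
  end.

Lemma opwordD b n x y : opword b n (x + y) = opword b n x + opword b n y.
Proof. by elim: n => //= n ->; rewrite linearD. Qed.

Lemma opwordZ b n a x : opword b n (a *: x) = a *: opword b n x.
Proof. by elim: n => //= n ->; rewrite linearZ. Qed.

Lemma opwordSr b n x : opword b n.+1 x = opword (~~ b) n (U b x).
Proof.
elim: n => [|n IH]; first by rewrite /= addbF.
by rewrite -[LHS]/(U _ (opword b n.+1 x)) IH /= addbN addNb.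
Qed.

Lemma klop_eq b x : U b x = klop b x + q *: x.
Proof. by rewrite /klop subrK. Qed.

Lemma klopN b x : klop b (- x) = - klop b x.
Proof. by rewrite /klop linearN scalerN opprD opprK. Qed.

Lemma klop_desc b x : U b (klop b x) = - qV *: klop b x.
Proof.
rewrite /klop linearB linearZ /= quad /xi scalerBl scalerBr !scaleNr scalerA.
by rewrite Defs.mulVq scale1r opprK [_ *: _ - _]addrC addrA addrK addrC.
Qed.

Lemma path_seqSS b z n :
  path_seq b z n.+2 = klop (b (+) odd n) (path_seq b z n.+1) - path_seq b z n.
Proof. by []. Qed.

Lemma path_ascent b z n : U (b (+) odd n) (path_seq b z n.+1) =
  path_seq b z n.+2 + path_seq b z n + q *: path_seq b z n.+1.
Proof. by rewrite path_seqSS subrK -klop_eq. Qed.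

Section Path.
Variables (b : bool) (z : V).
Hypothesis z_desc : U (~~ b) z = - qV *: z.
Local Notation P := (path_seq b z).

(** In P n.+2 = C_r (P n.+1) - P n the first term is in the image of C_r and the
    second has the descent r by induction, letters two steps apart being equal. *)
Lemma path_desc n : U (b (+) odd n) (P n) = - qV *: P n.
Proof.
suff [] : U (b (+) odd n) (P n) = - qV *: P n /\
  U (b (+) odd n.+1) (P n.+1) = - qV *: P n.+1 by [].
elim: n => [|n [IH1 IH2]]; first by rewrite /= linear0 scaler0 addbT.
split=> //; rewrite /= negbK -/(path_seq b z n.+1) linearB /= klop_desc IH1.
by rewrite [RHS]scalerBr.
Qed.

(** Words applied to z and vertices of the path differ by one step only: in
    T_r (P n.+1 + q P n) the neighbour P n produced by the first term cancels
    the second one, for which r is a descent. *)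
Lemma opword_path n : opword b n z = P n.+1 + q *: P n.
Proof.
elim: n => [|n IH]; first by rewrite /= scaler0 addr0.
rewrite [LHS]/= IH linearD linearZ /= -/(P n.+1) path_ascent path_desc.
rewrite scaleNr scalerN scalerA mulqV scale1r.
by rewrite -[_ + _ - _]addrA addrAC -addrA addrAC addrK addrC.
Qed.

Section Reflection.
Variable N : nat.
Hypotheses (N_gt0 : (0 < N)%N) (PN : P N = 0).

(** The recursion can be run in both directions. From a zero at N the two runs
    agree up to sign, since letters at equal distance from N coincide. *)
Lemma path_reflect i : (i <= N)%N -> P (N + i) = - P (N - i).
Proof.
suff : (i <= N -> P (N + i) = - P (N - i))%N /\
       (i.+1 <= N -> P (N + i.+1) = - P (N - i.+1))%N by case.
elim: i => [|i [IH1 IH2]].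
  split=> [_|_]; first by rewrite addn0 subn0 PN oppr0.
  case: N N_gt0 PN => // n _ Pn; rewrite addn1 path_seqSS Pn /klop linear0.
  by rewrite scaler0 subr0 sub0r subn1.
split=> // iN; rewrite !addnS path_seqSS -addnS IH2 ?IH1; try lia.
have -> : (N - i)%N = (N - i.+2).+2 by lia.
rewrite path_seqSS klopN (_ : (N - i.+1)%N = (N - i.+2).+1); last by lia.
have -> : odd (N + i) = odd (N - i.+2) by lia.
by rewrite opprK addrA addNr sub0r.
Qed.

Lemma path_period j : P (N.*2 + j) = P j.
Proof.
suff : P (N.*2 + j) = P j /\ P (N.*2 + j.+1) = P j.+1 by case.
elim: j => [|j [IH1 IH2]].
  have P2N : P N.*2 = 0 by rewrite -addnn path_reflect // subnn oppr0.
  rewrite addn0; split=> //; rewrite addn1 -(prednK N_gt0) doubleS path_seqSS.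
  rewrite -doubleS prednK // P2N /klop linear0 scaler0 subr0 sub0r.
  rewrite (_ : N.-1.*2.+1 = (N + N.-1))%N; last by lia.
  by rewrite path_reflect ?leq_pred // opprK (_ : (N - N.-1 = 1)%N) //; lia.
split=> //; rewrite !addnS !path_seqSS -addnS IH1 IH2.
by rewrite oddD odd_double.
Qed.

(** The reflection in N and the translation by 2 N generate an infinite dihedral
    group, which folds every index into the interval from 0 to N. *)
Lemma path_folding n :
  ((N %| n)%N -> P n = 0) /\
  (~~ (N %| n)%N ->
     exists2 i, (0 < i < N)%N && (i <= n)%N & P n = P i \/ P n = - P i).
Proof.
elim/ltn_ind: n => n IH; have [nN|] := ltnP n N.
  have [->|n0] := posnP n; first by rewrite dvdn0.
  split=> [/(dvdn_leq n0)|_]; first by rewrite leqNgt nN.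
  by exists n; [rewrite n0 nN leqnn | left].
have [n2N|N2n] := ltnP n N.*2 => Nn.
  have -> : P n = - P (N.*2 - n).
    rewrite -[in LHS](subnKC Nn) path_reflect; last by lia.
    by congr (- P _); lia.
  split=> [/dvdnP[k nk]|nd].
    have k1 : k = 1%N.
      have : (k < 2)%N by rewrite -(ltn_pmul2r N_gt0) -nk mul2n.
      by case: k nk => [|[]] //; lia.
    by rewrite nk k1 mul1n -addnn addnK PN oppr0.
  exists (N.*2 - n)%N; last by right.
  have : n != N by apply: contraNneq nd => ->.
  by lia.
have [IH1 IH2] : _ := IH (n - N.*2)%N ltac:(lia).
rewrite -(subnKC N2n) path_period -muln2 dvdn_addr ?dvdn_mulr // muln2.
by split=> // /IH2[i h1 h2]; exists i => //; lia.
Qed.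

End Reflection.

(** If N does not divide n, then P n is P i or - P i with 0 < i < N. A vector P i
    having both letters as descents would satisfy
    P i.+1 + P i.-1 + (q + q^-1) P i = 0, which the coordinates kap forbid: they
    are triangular with respect to P 1, ..., P N.-1. *)
Lemma path_double_descent N n (kap : nat -> V -> laurent) :
    (forall i a x y, kap i (a *: x + y) = a * kap i x + kap i y) ->
    (0 < N)%N -> P N = 0 ->
    (forall i, (0 < i < N)%N -> kap i (P i) = 1) ->
    (forall i j, (j < i < N)%N -> kap i (P j) = 0) ->
    (forall c, U c (P n) = - qV *: P n) -> (N %| n)%N.
Proof.
move=> kap_lin N0 PN kap1 kap0 dd; apply/negP => /negP nd.
have [_ /(_ nd)[i /andP[/andP[i0 iN] _] Pni]] := path_folding N0 PN n.
have ddi c : U c (P i) = - qV *: P i.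
  case: Pni (dd c) => -> //; rewrite linearN scalerN.
  by move/oppr_inj.
have asc : U (b (+) odd i.-1) (P i) = P i.+1 + P i.-1 + q *: P i.
  by case: (i) i0 => // j _; rewrite path_ascent.
have := ddi (b (+) odd i.-1); rewrite asc.
move/eqP; rewrite -subr_eq0 scaleNr opprK -addrA -scalerDl => /eqP.
rewrite -addrA => e.
have kz j : kap j 0 = 0.
  by have := kap_lin j (-1) 0 0; rewrite scaler0 addr0 mulN1r addNr.
have kapD j x y : kap j (x + y) = kap j x + kap j y.
  by have := kap_lin j 1 x y; rewrite scale1r mul1r.
have kapZ j a x : kap j (a *: x) = a * kap j x.
  by have := kap_lin j a x 0; rewrite addr0 kz addr0.
(* The coordinate i.+1 sees only P i.+1, unless i is the last index. *)
have [iN'|iN'] := ltnP i.+1 N.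
  have := congr1 (kap i.+1) e; rewrite !kapD kapZ kz kap1 ?kap0; try lia.
  by move/eqP; rewrite mulr0 !addr0 oner_eq0.
have iN2 : i.+1 = N by lia.
have := congr1 (kap i) e; rewrite iN2 PN add0r kapD kapZ kz kap1 ?kap0; try lia.
by move/eqP; rewrite add0r mulr1 (negPf q_plus_qV_neq0).
Qed.

End Path.

Variable e : V.
(** Whatever e is, C_b e is an eigenvector of T_b for -q^-1, so that two paths
    issue from e. They are the two branches of the W-graph of a dihedral group
    around the vertex of 1. *)
Definition side_seq (b : bool) (n : nat) : V := path_seq (~~ b) (klop b e) n.
Local Notation Q := side_seq.

Lemma side_start b : U (~~ ~~ b) (klop b e) = - qV *: klop b e.
Proof. by rewrite negbK klop_desc. Qed.

(** T_b e = C_b e + q e, and [opword_path] applies to the first term. *)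
Lemma opword_sides b n :
  opword b n.+1 e = Q b n.+1 + q *: Q b n + q *: opword (~~ b) n e.
Proof.
by rewrite opwordSr klop_eq opwordD opwordZ (opword_path (side_start b)).
Qed.

(** All terms but the leading ones are symmetric in the two sides, by
    induction. *)
Lemma opword_diff b n : opword b n e - opword (~~ b) n e = Q b n - Q (~~ b) n.
Proof.
elim: n => [|n]; first by rewrite /= !subrr.
move/eqP; rewrite subr_eq => /eqP IH.
rewrite !opword_sides negbK -![Q _ _ + _ + _]addrA -!scalerDr.
have -> : Q b n + opword (~~ b) n e = Q (~~ b) n + opword b n e.
  by rewrite IH addrA [Q (~~ b) n + _]addrC subrK.
by rewrite opprD addrA addrACA subrr addr0.
Qed.

(** The form in which triangularity is read off: everything but the leading
    term is divisible by q. *)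
Lemma opword_lead b n :
  opword b n.+1 e = Q b n.+1 + q *: (opword b n e + Q (~~ b) n).
Proof.
rewrite opword_sides -addrA -scalerDr; congr (_ + q *: _).
have /eqP := opword_diff b n; rewrite subr_eq => /eqP ->.
by rewrite addrAC subrK.
Qed.

(** On the vector e, the braid relation of length n says that the two paths
    issuing from e meet at the index n. *)
Lemma opword_commute n :
  (opword true n e = opword false n e) <-> (Q true n = Q false n).
Proof.
have /= h := opword_diff true n.
split=> E; move: h; rewrite E subrr => /eqP; last by rewrite subr_eq0 => /eqP.
by rewrite eq_sym subr_eq0 => /eqP.
Qed.

End TwoOperators.

Section BraidStable.
Import GRing.Theory.
Local Open Scope ring_scope.
Variables (V : lmodType laurent) (U : bool -> {linear V -> V}).
Hypothesis quad : forall b x, U b (U b x) = x + xi *: U b x.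

(** If B denotes the difference of the two alternating words of length m, then
    B T_c = - T_d^-1 B for some letter d, so that the kernel of B is stable. A
    braid relation thus has to be checked on generators of a module only. *)
Lemma braid_stable m x c : (0 < m)%N -> opword U true m x = opword U false m x ->
  opword U true m (U c x) = opword U false m (U c x).
Proof.
move=> m0 /[dup] h0.
have {}h0 : opword U c m x = opword U (~~ c) m x by case: c; rewrite h0.
suff : opword U (~~ c) m (U c x) = opword U c m (U c x) by case: c {h0} => /= ->.
rewrite -opwordSr /=; case: m m0 h0 => // n _ h0.
rewrite [RHS]opwordSr quad opwordD opwordZ -opwordSr h0.
by rewrite [in LHS]/= addbN -addNb quad.
Qed.

End BraidStable.

(** * Modules over the Hecke algebra as pairs of operators *)
Section Restriction.
Import GRing.Theory.
Local Open Scope ring_scope.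
Variables (W : finGroupType) (S : {set W}) (M : lmodType (hecke S)).

(** Over A the generators of the Hecke algebra act by linear operators, to which
    the preceding theory applies. *)
Definition over_laurent : Type := M.
HB.instance Definition _ := GRing.Zmodule.on over_laurent.

Definition laurent_scale (a : laurent) (x : over_laurent) : over_laurent :=
  (a%:A : hecke S) *: (x : M).

Fact laurent_scaleA a b x :
  laurent_scale a (laurent_scale b x) = laurent_scale (a * b) x.
Proof. by rewrite /laurent_scale [LHS]scalerA -scalerAl mul1r scalerA. Qed.
Fact laurent_scale1 : left_id 1 laurent_scale.
Proof. by move=> x; rewrite /laurent_scale scale1r [LHS]scale1r. Qed.
Fact laurent_scaleDr : right_distributive laurent_scale +%R.
Proof. by move=> a x y; rewrite /laurent_scale [LHS]scalerDr. Qed.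
Fact laurent_scaleDl x : {morph laurent_scale^~ x : a b / a + b}.
Proof. by move=> a b; rewrite /laurent_scale scalerDl [LHS]scalerDl. Qed.

HB.instance Definition _ := GRing.Zmodule_isLmodule.Build laurent over_laurent
  laurent_scaleA laurent_scale1 laurent_scaleDr laurent_scaleDl.

Definition hecke_act (h : hecke S) (x : over_laurent) : over_laurent :=
  h *: (x : M).

Fact hecke_act_linear h : linear (hecke_act h).
Proof.
move=> a x y; rewrite /hecke_act [LHS]scalerDr; congr (_ + _).
rewrite -[RHS]/(a%:A *: (h *: (x : M))) -[LHS]/(h *: (a%:A *: (x : M))).
by rewrite !scalerA mulr_algl mulr_algr.
Qed.
HB.instance Definition _ h :=
  GRing.isLinear.Build laurent over_laurent over_laurent _ (hecke_act h)
    (hecke_act_linear h).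

End Restriction.

Section MatrixModule.
Import GRing.Theory.
Local Open Scope ring_scope.
Variables (W : finGroupType) (S : {set W}) (n : nat).
Variable f : {r : W | r \in S} -> 'M[laurent]_n.+1.

(** The proof of the Hecke relations is an argument of the type, so that the
    module structure can be attached to it. *)
Definition matrix_module (rel : hecke_rel (@scalar_mx laurent n.+1) f) : Type :=
  'cV[laurent]_n.+1.
Variable rel : hecke_rel (@scalar_mx laurent n.+1) f.
Local Notation M := (matrix_module rel).
HB.instance Definition _ := GRing.Zmodule.on M.

Definition matrix_scale (h : hecke S) (x : M) : M :=
  hecke_eval (@scalar_mx laurent n.+1) f h *m x.

Let evC a : hecke_eval (@scalar_mx laurent n.+1) f a%:A = a%:M.
Proof. exact: (hecke_evalC rel). Qed.

Fact matrix_scaleA g h x : matrix_scale g (matrix_scale h x) = matrix_scale (g * h) x.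
Proof. by rewrite /matrix_scale mulmxA (hecke_evalM rel). Qed.
Fact matrix_scale1 : left_id 1 matrix_scale.
Proof. by move=> x; rewrite /matrix_scale -[1]scale1r evC mul1mx. Qed.
Fact matrix_scaleDr : right_distributive matrix_scale +%R.
Proof. by move=> h x y; rewrite /matrix_scale [LHS]mulmxDr. Qed.
Fact matrix_scaleDl x : {morph matrix_scale^~ x : g h / g + h}.
Proof. by move=> g h; rewrite /matrix_scale (hecke_evalD rel) mulmxDl. Qed.

HB.instance Definition _ := GRing.Zmodule_isLmodule.Build (hecke S) M
  matrix_scaleA matrix_scale1 matrix_scaleDr matrix_scaleDl.

Lemma matrix_module_T r (x : M) : T r *: x = f r *m x.
Proof. by rewrite -[LHS]/(matrix_scale _ _) /matrix_scale (hecke_evalT rel). Qed.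

Lemma matrix_module_C a (x : M) :
  (a%:A : hecke S) *: x = a *: (x : 'cV[laurent]_n.+1).
Proof. by rewrite -[LHS]/(matrix_scale _ _) /matrix_scale evC mul_scalar_mx. Qed.

(** Both sides are multiplicative in h, so the identity reduces to
    bar T_r = T_r - (q - q^-1). *)
Lemma matrix_module_bar :
    (forall r, map_mx abar (f r) = f r - xi%:M) ->
  forall h (x : M), map_mx abar (h *: x) = hbar h *: (map_mx abar x : M).
Proof.
move=> fbar h; elim/hecke_ind: h => [r|a|g h IHg IHh|g h IHg IHh] x.
- rewrite hbarT /TV scalerBl !matrix_module_T matrix_module_C map_mxM fbar.
  by rewrite mulmxBl mul_scalar_mx.
- by rewrite hbarC !matrix_module_C map_mxZ.
- by rewrite hbarD !scalerDl map_mxD IHg IHh.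
- by rewrite hbarM -!scalerA IHg IHh.
Qed.

End MatrixModule.

(** * Alternating words in a dihedral group *)
Section Dihedral.
Variables (m : nat) (W : finGroupType) (s t : W).
Hypothesis m_ge2 : 2 <= m.
Hypothesis cox : coxeter_I2 m s t.
Local Notation S := [set s; t].
Local Notation len := (len S).

(** Booleans name the generators, [~~ b] being the other one, so that statements
    symmetric in s and t are made once. *)
Definition gen_elt (b : bool) : W := if b then t else s.
(** The last letter is b: aword true l and aword false l are the alternating
    words ending in t and in s. The letter that lengthens aword b l on the left
    is b (+) odd l. *)
Definition aword (b : bool) (l : nat) : W :=
  alt_word (gen_elt (~~ b)) (gen_elt b) l.
Local Notation g := gen_elt.
Local Notation aw := aword.

Section Words.
Local Open Scope group_scope.

Lemma gen_sq b : g b * g b = 1.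
Proof. by case: cox => _; rewrite !expg2 => ss tt _ _; case: b. Qed.

Lemma gen_eltK b : involutive (mulg (g b)).
Proof. by move=> w; rewrite mulgA gen_sq mul1g. Qed.

Lemma gen_in b : g b \in S.
Proof. by case: b; rewrite !inE eqxx ?orbT. Qed.

Lemma genP r : r \in S -> exists b, r = g b.
Proof. by rewrite !inE => /orP[]/eqP->; [exists false|exists true]. Qed.

Lemma aword0 b : aword b 0 = 1. Proof. by []. Qed.

Lemma aword1 b : aword b 1 = g b.
Proof. by rewrite /aword /alt_word /= mulg1. Qed.

Lemma awordS b l : aword b l.+1 = g (b (+) odd l) * aword b l.
Proof.
rewrite /aword /alt_word /= uphalf_half; case: (odd l) => /=.
  by rewrite addbT add1n expgS mulgA.
by rewrite addbF add0n.
Qed.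

Lemma aword_add b i j : aword b (i + j) = aword (b (+) odd j) i * aword b j.
Proof.
elim: i => [|i IH]; first by rewrite aword0 mul1g.
by rewrite addSn !awordS IH mulgA oddD addbAC addbA.
Qed.

Lemma awordSr b l : aword b l.+1 = aword (~~ b) l * g b.
Proof. by rewrite -addn1 aword_add aword1 addbT. Qed.

Lemma awordV b l : (aword b l)^-1 = aword (~~ b (+) odd l) l.
Proof.
elim: l b => [|l IH] b; first by rewrite !aword0 invg1.
have gV c : (g c)^-1 = g c by apply/eqP; rewrite eq_invg_mul gen_sq.
rewrite awordS invMg IH [RHS]awordSr gV /=.
by congr (aword _ _ * g _); case: b; case: odd.
Qed.

(** The reflections x |-> - x and x |-> 1 - x of Z/m satisfy the relations, and
    their product is a translation of order m. *)
Lemma order_rotation : #[s * t] = m.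
Proof.
case: cox => _ _ _ stm univ.
have oppI : injective (fun x : 'Z_m => - x)%R by apply: GRing.oppr_inj.
have refI : injective (fun x : 'Z_m => 1 - x)%R.
  by move=> x y /GRing.addrI /GRing.oppr_inj.
have rot j x : ((perm oppI * perm refI) ^+ j) x = (x + j%:R)%R.
  elim: j x => [|j IH] x; first by rewrite perm1 GRing.addr0.
  rewrite expgSr permM IH permM !permE /= GRing.opprK.
  by rewrite GRing.addrC -GRing.addrA GRing.natr1.
have [||| f [fM fs ft]] := univ {perm 'Z_m} (perm oppI) (perm refI).
- by apply/permP=> x; rewrite expg2 permM !permE GRing.opprK.
- apply/permP=> x; rewrite expg2 permM !permE /=.
  by rewrite GRing.opprB GRing.addrC GRing.subrK.
- apply/permP=> x; rewrite rot perm1.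
  by rewrite (pchar_Zp m_ge2) GRing.addr0.
apply/eqP; rewrite eqn_dvd order_dvdn stm eqxx /=.
set k := #[_]; have : (s * t) ^+ k = 1 by apply: expg_order.
have f1 : f 1 = 1 by apply: (mulIg (f 1)); rewrite -fM !mul1g.
have fX w j : f (w ^+ j) = f w ^+ j.
  by elim: j => // j IH; rewrite !expgS fM IH.
move/(congr1 f); rewrite f1 fX fM fs ft => /permP /(_ 0%R).
rewrite rot perm1 GRing.add0r => /(congr1 val) /=.
by rewrite val_Zp_nat // => /eqP; rewrite -/(dvdn m k).
Qed.

(** The sign character, with the transposition of the two booleans as -1. *)
Lemma aword_odd_neq1 b l : odd l -> aword b l != 1.
Proof.
case: cox => _ _ _ _ univ ol.
have [||| f [fM fs ft]] := univ {perm bool} (perm negb_inj) (perm negb_inj).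
- by apply/permP=> x; rewrite expg2 permM !permE negbK.
- by apply/permP=> x; rewrite expg2 permM !permE negbK.
- have -> : perm negb_inj * perm negb_inj = 1.
    by apply/permP=> x; rewrite permM !permE negbK.
  by rewrite expg1n.
have f1 : f 1 = 1 by apply: (mulIg (f 1)); rewrite -fM !mul1g.
have fa x : f (aword b l) x = x (+) odd l.
  elim: (l) x => [|j IH] x; first by rewrite f1 perm1 addbF.
  rewrite awordS fM permM IH /g.
  by case: (b (+) _); rewrite ?fs ?ft permE /=; case: x; case: odd.
by apply/eqP => e; have := fa false; rewrite e f1 perm1 ol.
Qed.

Lemma aword_eq1 b l : (aword b l == 1) = (m.*2 %| l).
Proof.
have [ol|el] := boolP (odd l).
  rewrite (negPf (aword_odd_neq1 _ ol)); apply/esym/negP => /dvdn_odd /(_ ol).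
  by rewrite odd_double.
rewrite /aword /alt_word (negPf el) -order_dvdn.
have -> : #[g (~~ b) * g b] = m.
  case: b => //=; first exact: order_rotation.
  rewrite -[RHS]order_rotation -(orderV (t * s)) invMg; congr #[_ * _].
    by apply/eqP; rewrite eq_invg_mul (gen_sq false).
  by apply/eqP; rewrite eq_invg_mul (gen_sq true).
by rewrite -[X in _ = (_ %| X)](even_halfK el) -!muln2 dvdn_pmul2r.
Qed.

Lemma aword_m b : aword b m = aword (~~ b) m.
Proof.
apply/eqP; rewrite eq_mulgV1 awordV negbK -{1}[b](addbK (odd m)) -aword_add.
by rewrite addnn aword_eq1.
Qed.

Lemma aword_same b i j : (aword b (i + j) == aword b j) = (m.*2 %| i).
Proof. by rewrite aword_add -{2}[aword b j]mul1g (inj_eq (mulIg _)) aword_eq1. Qed.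

Lemma aword_opp b i j : (aword b i == aword (~~ b) j) = (m.*2 %| i + j).
Proof.
by rewrite eq_mulgV1 awordV negbK -{1}[b](addbK (odd j)) -aword_add aword_eq1.
Qed.

(** On the cycle of length 2 m that is the Cayley graph, aword true l and
    aword false l sit at the positions l and - l. *)
Lemma aword_inj b b' i j : i <= m -> j <= m -> aword b i = aword b' j ->
  i = j /\ [\/ b = b', i = 0 | i = m]%N.
Proof.
have small k : k < m.*2 -> m.*2 %| k -> k = 0%N.
  by case: k => // k lk /dvdn_leq h; move: (h isT); lia.
move=> im jm /eqP; have [<-|nb] := eqVneq b b'.
  case: (leqP j i) => [ji|/ltnW ij].
    rewrite -{1}(subnK ji) aword_same => /small h.
    by split; [lia | constructor].
  rewrite eq_sym -{1}(subnK ij) aword_same => /small h.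
  by split; [lia | constructor].
have -> : b' = ~~ b by case: b b' nb => [] [].
rewrite aword_opp => h; have [ij|] := ltnP (i + j) m.*2.
  by have := small _ ij h; split; [lia | constructor 2; lia].
by split; [lia | constructor 3; lia].
Qed.

Lemma aword_up b l : g (b (+) odd l) * aword b l = aword b l.+1.
Proof. by rewrite awordS. Qed.

Lemma aword_down b l : 0 < l -> g (b (+) ~~ odd l) * aword b l = aword b l.-1.
Proof. by case: l => // l _; rewrite awordS /= negbK gen_eltK. Qed.

Lemma awordP w : exists b l, l <= m /\ w = aword b l.
Proof.
have : w \in <<S>> by case: cox => -> *; rewrite inE.
case/gen_prodgP=> n [c cS ->].
elim/big_rec: _ => [|i _ _ [b [l [lm ->]]]]; first by exists true, 0%N.
have [d ->] := genP (cS i).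
have [->|dn] := eqVneq d (b (+) odd l).
  rewrite aword_up; move: lm; rewrite leq_eqVlt => /orP[/eqP->|lm]; last first.
    by exists b, l.+1.
  exists (~~ b), m.-1; split; first by lia.
  rewrite awordS aword_m -[m in odd m](@prednK m) ?(ltnW m_ge2) //=.
  rewrite -[X in aword _ X](@prednK m) ?(ltnW m_ge2) // awordS.
  by rewrite addbN -addNb gen_eltK.
have -> : d = b (+) ~~ odd l by case: d b dn => [] []; case: odd.
case: l lm {dn} => [|l] lm; last by exists b, l; rewrite aword_down // ltnW.
by exists (~~ b), 1%N; rewrite mulg1 aword1 addbT; split => //; lia.
Qed.

Lemma aword_mem_expg b l : aword b l \in S ^+ l.
Proof.
elim: l => [|l IH]; first by rewrite expg0 aword0 inE.
by rewrite awordS expgS mem_mulg ?gen_in.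
Qed.

Lemma mem_expg_aword w k : w \in S ^+ k -> exists b l, l <= k /\ w = aword b l.
Proof.
elim: k w => [|k IH] w; first by rewrite expg0 inE => /eqP->; exists true, 0%N.
rewrite expgS => /mulsgP[r v /genP[d ->] /IH[b [l [lk ->]]] ->].
have [->|dn] := eqVneq d (b (+) odd l).
  by rewrite aword_up; exists b, l.+1.
have -> : d = b (+) ~~ odd l by case: d b dn => [] []; case: odd.
case: l lk {dn} => [|l] lk; last by exists b, l; rewrite aword_down //; split=> //; lia.
by exists (~~ b), 1%N; rewrite mulg1 aword1 addbT.
Qed.

Lemma len_aword b l : l <= m -> len (aword b l) = l.
Proof.
move=> lm; rewrite /len; case: pselect => [e|[]]; last first.
  by exists l; apply: aword_mem_expg.
case: ex_minnP => k kS kmin; have kl := kmin _ (aword_mem_expg b l).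
have [b' [i [ik e']]] := mem_expg_aword kS.
have [//|] := aword_inj lm _ e'; first exact: leq_trans (leq_trans ik kl) lm.
by move=> li _; apply/eqP; rewrite eqn_leq kl li ik.
Qed.

Lemma len_up b l : l < m -> len (g (b (+) odd l) * aword b l) = l.+1.
Proof. by move=> lm; rewrite aword_up len_aword. Qed.

Lemma len_down b l : 0 < l <= m -> len (g (b (+) ~~ odd l) * aword b l) = l.-1.
Proof. by case/andP=> l0 lm; rewrite aword_down // len_aword //; lia. Qed.

Lemma len_top b c : len (g c * aword b m) = m.-1.
Proof.
have [->|cn] := eqVneq c (b (+) odd m); last first.
  have -> : c = b (+) ~~ odd m by case: c b cn => [] []; case: odd.
  by apply: len_down; lia.
rewrite aword_m -[b]negbK addNb negbK -addbN.
by apply: len_down; lia.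
Qed.

Lemma len1 : len 1 = 0%N.
Proof. exact: (@len_aword true 0). Qed.

Lemma len_gen b : len (g b) = 1%N.
Proof. by rewrite -aword1 len_aword // ltnW. Qed.

(** The exclusive disjunction is the form that linear arithmetic can use. *)
Lemma len_genM b w :
  (len (g b * w) == (len w).+1) (+) (len w == (len (g b * w)).+1).
Proof.
have [c [l [lm ->]]] := awordP w; rewrite (len_aword _ lm).
have [->|bn] := eqVneq b (c (+) odd l).
  move: lm; rewrite leq_eqVlt => /orP[/eqP->|lm]; first by rewrite len_top; lia.
  by rewrite len_up //; lia.
have -> : b = c (+) ~~ odd l by case: b c bn => [] []; case: odd.
case: l lm {bn} => [|l] lm; last by rewrite len_down /=; lia.
by rewrite mulg1 len_gen.
Qed.

Lemma aword_reflection b l : odd l -> aword b l \in reflections S.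
Proof.
move=> ol; rewrite -[l]odd_double_half ol add1n; elim: (l./2) b => [|k IH] b.
  by rewrite aword1 /reflections -(conjg1 (g b)) memJ_class_support ?gen_in ?inE.
have -> : aword b k.+1.*2.+1 = aword (~~ b) k.*2.+1 ^ g b.
  rewrite doubleS awordS awordSr /= odd_double addbF conjgE !mulgA.
  by congr (_ * _ * _); apply/esym/eqP; rewrite eq_invg_mul gen_sq.
case/imset2P: (IH (~~ b)) => x y xS _ ->.
by rewrite -conjgM; apply: memJ_class_support; rewrite ?xS // inE.
Qed.

(** Odd alternating words are palindromes, hence reflections, so that elements
    whose lengths differ in parity are comparable in one step; when the parities
    agree there is an element of intermediate length. *)
Lemma bruhat_ltE u v : bruhat_lt S u v = (len u < len v).
Proof.
apply/andP/idP=> [[nuv /connectP[p pth e]]|luv]; last first.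
  split; first by apply: contraTneq luv => ->; rewrite ltnn.
  have step b b' i j : i < j <= m -> odd (i + j) ->
      connect [rel x y | (y * x^-1 \in reflections S) && (len x < len y)]
        (aword b i) (aword b' j).
    case/andP=> ij jm oij; apply: connect1; rewrite /= !len_aword ?ij; try lia.
    rewrite andbT; have [<-|nb] := eqVneq b b'.
      rewrite -(subnK (ltnW ij)) aword_add mulgK aword_reflection //.
      by rewrite oddB ?(ltnW ij) // -oddD addnC.
    have -> : b = ~~ b' by case: b b' nb => [] [].
    rewrite awordV negbK -{1}[b'](addbK (odd i)) -aword_add.
    by rewrite aword_reflection // addnC.
  move: luv; have [b [i [im ->]]] := awordP u.
  have [b' [j [jm ->]]] := awordP v; rewrite !len_aword // => ij.
  rewrite /bruhat_le; have [oij|] := boolP (odd (i + j)).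
    by apply: step; rewrite ?ij.
  move=> eij; apply: (connect_trans (step b b i i.+1 _ _)); first by lia.
    by rewrite addnS oddS addnn odd_double.
  apply: step; last by rewrite addSn oddS eij.
  rewrite jm andbT ltn_neqAle ij andbT; apply: contraNneq eij => <-.
  by rewrite addnS oddS addnn odd_double.
case: p pth e => [_ /= e|x p]; first by rewrite e eqxx in nuv.
move=> /= /andP[/andP[_ ux]] + e; move: ux; rewrite {}e {nuv}.
elim: p x => [//|y p IH] x ux /= /andP[/andP[_ xy]].
by apply: IH; apply: ltn_trans xy.
Qed.

Lemma len_le w k : w \in S ^+ k -> len w <= k.
Proof.
move=> wk; rewrite /len; case: pselect => [e|[]]; last by exists k.
by case: ex_minnP => i _; apply.
Qed.

Lemma mem_expg_len w : w \in S ^+ len w.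
Proof.
have [b [l [lm ->]]] := awordP w.
by rewrite len_aword //; apply: aword_mem_expg.
Qed.

Lemma len_mul_le u v : len (u * v) <= len u + len v.
Proof. by apply: len_le; rewrite expgD mem_mulg ?mem_expg_len. Qed.

(** If v is strictly below w, removing the first letter of a reduced word of
    w v^-1 shortens w and keeps it above v. *)
Lemma weak_idealP (I : {set W}) : weak_ideal S I <->
  I != set0 /\ forall b w, w \in I -> len (g b * w) < len w -> g b * w \in I.
Proof.
split=> -[I0 cl]; split=> //; [move=> b w wI lw | move=> v w].
  apply: (cl _ w) => //; rewrite /weak_le invMg mulgA mulgV mul1g.
  have -> : (g b)^-1 = g b by apply/eqP; rewrite eq_invg_mul gen_sq.
  by rewrite len_gen; have := len_genM b w; lia.
move: {2}(len (w * v^-1)) (erefl (len (w * v^-1))) => k.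
elim: k w => [|k IH] w e; rewrite /weak_le e.
  have := mem_expg_len (w * v^-1); rewrite e expg0 inE -eq_mulgV1 => /eqP->.
  by [].
move=> lw wI; have [c [l [lm u_aw]]] := awordP (w * v^-1).
have l_k : l = k.+1 by rewrite -e u_aw len_aword.
have gw : g (c (+) ~~ odd l) * w = aword c k * v.
  by rewrite -[w](mulgKV v) u_aw mulgA aword_down l_k.
have l_gw : len (g (c (+) ~~ odd l) * w * v^-1) = k.
  by rewrite gw mulgK len_aword //; lia.
have := len_mul_le (aword c k) v; rewrite -gw len_aword; last by lia.
move=> le_gw; apply: (IH (g (c (+) ~~ odd l) * w)) => //.
  by rewrite /weak_le l_gw; have := len_genM (c (+) ~~ odd l) w; lia.
by apply: cl => //; lia.
Qed.

Lemma ideal_heights (I : {set W}) : I != set0 ->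
    (forall b w, w \in I -> len (g b * w) < len w -> g b * w \in I) ->
  exists h : bool -> nat, forall b, h b <= m /\
    forall i, i <= m -> (aword b i \in I) = (i <= h b).
Proof.
move=> /set0Pn[w0 w0I] cl.
have one b i : i <= m -> aword b i \in I -> forall j, j <= i -> aword b j \in I.
  elim: i => [|i IH] im iI j; first by rewrite leqn0 => /eqP->.
  rewrite leq_eqVlt => /orP[/eqP->|ji] //; apply: IH => //; first exact: ltnW.
  have := cl (b (+) ~~ odd i.+1) _ iI; rewrite aword_down //= !len_aword //.
    by apply.
  exact: ltnW.
have I1 : 1 \in I.
  by have [b [l [lm e]]] := awordP w0; apply: (one b l lm) (leq0n l); rewrite -e.
have ex b : exists i, (i <= m) && (aword b i \in I) by exists 0%N.
have ub b i : (i <= m) && (aword b i \in I) -> i <= m by case/andP.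
exists (fun b => ex_maxn (ex b) (ub b)) => b.
case: ex_maxnP => k /andP[km kI] kmax; split=> // i im.
apply/idP/idP => [iI|]; first by apply: kmax; rewrite im.
exact: one.
Qed.

Lemma aword_mulr b l c : l < m ->
  (len (aword b l) < len (aword b l * g c)) = (l == 0%N) || (c == ~~ b).
Proof.
move=> lm; have [->|cn] := eqVneq c (~~ b).
  by rewrite orbT -{2}[b]negbK -awordSr !len_aword ?ltnSn // ltnW.
have -> : c = b by case: c b cn => [] [].
rewrite orbF; case: l lm => [|l] lm; first by rewrite mul1g len_gen len1.
rewrite awordSr -mulgA gen_sq mulg1 -awordSr !len_aword ?(ltnW lm) //; last by lia.
by apply/negbTE; lia.
Qed.

Lemma D_all : D S S = [set 1].
Proof.
apply/setP=> w; rewrite !inE; apply/forall_inP/eqP => [h|-> r /genP[b ->]].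
  have [b [l [lm e]]] := awordP w; move: (h _ (gen_in b)); rewrite e.
  case: l lm {e} => // l lm.
  by rewrite awordSr -mulgA gen_sq mulg1 -awordSr !len_aword //; lia.
by rewrite mul1g len_gen len1.
Qed.

Lemma D_none : D S set0 = [set: W].
Proof. by apply/setP=> w; rewrite !inE; apply/forall_inP => r; rewrite inE. Qed.

Lemma mem_D1 b b' i : i <= m ->
  (aword b' i \in D S [set g (~~ b)]) = (i == 0%N) || (b' == b) && (i < m).
Proof.
rewrite inE leq_eqVlt => im.
transitivity (len (aword b' i) < len (aword b' i * g (~~ b))).
  by apply/forall_inP/idP => [|h r /set1P->//]; apply; rewrite inE.
have [i0|i0] := posnP i.
  by rewrite i0 aword_mulr ?eqxx // ltnW.
case/orP: im => [/eqP->|im].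
  have -> : aword b' m = aword (~~ b) m.
    by case: b b' => [] [] //=; rewrite aword_m.
  rewrite -[X in aword _ X * _](@prednK m) ?(ltnW m_ge2) // awordSr -mulgA gen_sq mulg1.
  by rewrite !len_aword ?ltnn ?andbF; lia.
by rewrite aword_mulr // im andbT; case: b b' => [] []; lia.
Qed.

End Words.

(** * W-graph ideals in terms of two operators *)
Section OperatorModel.
Import GRing.Theory.
Local Open Scope ring_scope.

(** The conditions on the module of a W-graph ideal, with U b the action of T_b.
    The action on strong descents is encoded in [model_up] and the quadratic
    relation; for weak ascents, the sum over smaller elements becomes membership
    in a step of the filtration by length, by [bruhat_ltE]. *)
Record ideal_model (I J : {set W}) (V : lmodType laurent)
    (U : bool -> {linear V -> V}) (v : W -> V) (bar : V -> V) : Prop := IdealModel {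
  model_quad : forall b x, U b (U b x) = x + xi *: U b x;
  model_braid : forall x, opword U true m x = opword U false m x;
  model_basis : is_basis I v;
  model_up : forall b w, w \in I -> (g b * w)%g \in I ->
    (len w < len (g b * w)%g)%N ->
    U b (v w) = v (g b * w)%g;
  model_WD : forall b w, w \in I -> (len w < len (g b * w)%g)%N ->
    (g b * w)%g \notin D S J -> U b (v w) = - qV *: v w;
  model_WA : forall b w, w \in I -> (len w < len (g b * w)%g)%N ->
    (g b * w)%g \in D S J -> (g b * w)%g \notin I ->
    exists2 x, cspan I len in_Zq v (len (g b * w)%g) x &
      U b (v w) = q *: v w - q *: x;
  model_barD : {morph bar : x y / x + y};
  model_barZ : forall a x, bar (a *: x) = abar a *: bar x;
  model_barK : involutive bar;
  model_bar1 : bar (v 1%g) = v 1%g;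
  model_barU : forall b x, bar (U b x) = U b (bar x) - xi *: bar x
}.

Definition hgen (b : bool) : {r : W | r \in S} := exist _ (g b) (gen_in b).

Lemma hgenP (r : {r : W | r \in S}) : exists b, r = hgen b.
Proof.
by case: (genP (valP r)) => b e; exists b; apply: val_inj; rewrite e.
Qed.

Lemma order_st b : #[(g b * g (~~ b))%g]%g = m.
Proof.
rewrite -[RHS]order_rotation; case: b => //=.
have gV c : (g c)^-1%g = g c.
  apply/eqP; rewrite eq_invg_mul; have := gen_eltK c 1%g.
  by rewrite mulg1 => ->.
rewrite -[RHS]orderV invMg; congr #[_ * _]%g; symmetry.
  exact: (gV true).
exact: (gV false).
Qed.

Lemma opword_braid (B : nzRingType) (V : lmodType laurent)
    (U : bool -> {linear V -> V}) (a : bool -> B) (act : B -> V -> V) :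
    (forall x, act 1 x = x) -> (forall x y z, act (x * y) z = act x (act y z)) ->
    (forall b x, U b x = act (a b) x) ->
  forall b k x, opword U b k x =
    act (braid_word (a (b (+) ~~ odd k)) (a (b (+) odd k)) k) x.
Proof.
move=> act1 actM actU b; elim=> [|k IH] x /=; first by rewrite act1.
by rewrite negbK actM -actU IH.
Qed.

Lemma wgraph_model (I J : {set W}) : wgraph_ideal S I J ->
  exists (V : lmodType laurent) (U : bool -> {linear V -> V}) (v : W -> V)
    (bar : V -> V), ideal_model I J U v bar.
Proof.
case=> _ _ [M [v [[gen free] act [bar [barD barZ barK bar1 barH]]]]].
exists (over_laurent M), (fun b => hecke_act (T (hgen b))), v, bar; split=> //.
- move=> b x; rewrite /hecke_act [LHS]scalerA T_quad [LHS]scalerDl scale1r.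
  by rewrite -[_ *: T _]mulr_algl -scalerA.
- move=> x.
  have op b k := @opword_braid (hecke S) (over_laurent M)
    (fun b => hecke_act (T (hgen b))) (fun b => T (hgen b)) (@hecke_act _ _ M)
    (fun x => scale1r (x : M)) (fun x y z => esym (scalerA x y (z : M)))
    (fun _ _ => erefl) b k.
  rewrite !op; congr (hecke_act _ _).
  have := T_braid (hgen (odd m)) (hgen (~~ odd m)).
  by rewrite /= order_st negbK.
- move=> b w wI rI lw.
  have [h _ _ _] := act (hgen b) w wI.
  by rewrite -h //= inE gen_in /= bruhat_ltE // lw.
- move=> b w wI lw rD.
  have [_ _ h _] := act (hgen b) w wI.
  by rewrite [LHS]h //= inE gen_in /= bruhat_ltE // lw.
- move=> b w wI lw rD rI.
  have [_ _ _ h] := act (hgen b) w wI.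
  case: h => [|p e]; first by rewrite /= inE gen_in /= bruhat_ltE // lw inE rI.
  exists (\sum_(y in I | (len y < len (g b * w)%g)%N)
            polyq (p y) *: (v y : over_laurent M)).
    by exists (fun y => polyq (p y)); split=> // y; exists (p y).
  rewrite [LHS]e scaler_sumr; congr (_ - _).
  apply: eq_big => [y|y _]; first by rewrite bruhat_ltE.
  by rewrite scalerA.
- move=> b x; rewrite /hecke_act [LHS]barH hbarT /TV scalerBl.
  by [].
Qed.

Lemma gen_inj : injective g.
Proof.
move=> b b'; rewrite -!aword1 => e.
have m1 := ltnW m_ge2.
by have [_ [//||/esym m1']] := aword_inj m1 m1 e; move: m_ge2; rewrite ?m1'.
Qed.

Lemma mulmx_ext n (B C : 'M[laurent]_n) :
  (forall x : 'cV_n, B *m x = C *m x) -> B = C.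
Proof.
move=> h; apply/matrixP=> i j; have /matrixP /(_ i 0) := h (delta_mx j 0).
by rewrite -!colE !mxE.
Qed.

Lemma in_SA (I : {set W}) b w :
  (g b \in SA S I w) = (len w < len (g b * w)%g)%N && ((g b * w)%g \in I).
Proof. by rewrite [LHS]in_set gen_in bruhat_ltE. Qed.
Lemma in_SD b w : (g b \in SD S w) = (len (g b * w)%g < len w)%N.
Proof. by rewrite [LHS]in_set gen_in bruhat_ltE. Qed.
Lemma in_WD (J : {set W}) b w :
  (g b \in WD S J w) = (len w < len (g b * w)%g)%N && ((g b * w)%g \notin D S J).
Proof. by rewrite [LHS]in_set gen_in bruhat_ltE. Qed.
Lemma in_WA (I J : {set W}) b w : (g b \in WA S I J w) =
  [&& (len w < len (g b * w)%g)%N, (g b * w)%g \notin I & (g b * w)%g \in D S J].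
Proof. by rewrite [LHS]in_set gen_in bruhat_ltE /= in_setD. Qed.

(** Conversely, matrices satisfying these conditions define a module of column
    vectors, on which the bar involution acts entrywise. *)
Lemma matrix_model_wgraph (I J : {set W}) n (A : bool -> 'M[laurent]_n.+1)
    (v : W -> 'cV_n.+1) :
    weak_ideal S I -> I \subset D S J ->
    ideal_model I J (fun b => mulmx (A b)) v (map_mx abar) ->
  wgraph_ideal S I J.
Proof.
move=> ideal_I ID [quad braid [gen free] up actWD actWA barD barZ barK bar1 barU].
have [_ closed_I] := (weak_idealP I).1 ideal_I.
pose f (r : {r : W | r \in S}) := A (val r == g true).
have fE b : f (hgen b) = A b.
  by rewrite /f [X in X == _](_ : _ = g b) // (inj_eq gen_inj) eqb_id.
have op b k x := @opword_braid 'M[laurent]_n.+1 'cV_n.+1 (fun b => mulmx (A b))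
    A (@mulmx _ _ _ _) (@mul1mx _ _ _) (fun x y z => esym (mulmxA x y z))
    (fun _ _ => erefl) b k x.
have rel : hecke_rel (@scalar_mx laurent n.+1) f.
  split=> [a r|r|r r'].
  - by rewrite -[LHS]/(_ *m _) -[RHS]/(_ *m _) scalar_mxC.
  - have [b ->] := hgenP r; rewrite fE; apply: mulmx_ext => x.
    rewrite -[_ * _]/(_ *m _) -mulmxA quad -[_ * _]/(_ *m _) mulmxDl mul1mx.
    by rewrite -mulmxA mul_scalar_mx.
  - have [b ->] := hgenP r; have [b' ->] := hgenP r'; rewrite !fE.
    have [->//|bb'] := eqVneq b b'; have -> : b' = ~~ b by case: b b' bb' => [] [].
    rewrite /= order_st; apply: mulmx_ext => x.
    have := braid x; rewrite !op /= negbK.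
    case: (odd m) => /= e; case: b {bb'} => //=.
split=> //; exists (matrix_module rel), v; split; first split.
- move=> x; have [c xE] := gen x; exists c; rewrite [LHS]xE.
  by apply: eq_bigr => w _; rewrite matrix_module_C.
- move=> c c0; apply: free; rewrite -[RHS]c0.
  by apply: eq_bigr => w _; rewrite matrix_module_C.
- move=> r w wI; have [b ->] := hgenP r; rewrite [val _]/(g b) in_SA in_SD in_WD in_WA.
  rewrite matrix_module_T fE !matrix_module_C; split.
  + by case/andP=> lw rI; apply: up.
  (* For a strong descent, w = r (r w) and T_r squared is known. *)
  + move=> lw; have rI := closed_I _ _ wI lw.
    have vE : A b *m v (g b * w)%g = v w.
      by rewrite [LHS](up b (g b * w)%g) ?gen_eltK.
    have qv : A b *m (A b *m v (g b * w)%g) =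
      v (g b * w)%g + xi *: (A b *m v (g b * w)%g) := quad b _.
    by rewrite vE in qv.
  + by case/andP=> lw rD; apply: actWD.
  + case/and3P=> lw rI rD; have [x [c [cZ xE]] e] := actWA b w wI lw rD rI.
    have [p pE] := choice cZ; exists p; rewrite [LHS]e xE scaler_sumr; congr (_ - _).
    apply: eq_big => [y|y _]; first by rewrite bruhat_ltE.
    by rewrite matrix_module_C scalerA pE.
- exists (map_mx abar); split=> // [a x|h x].
    by rewrite !matrix_module_C barZ.
  apply: matrix_module_bar => r; have [b ->] := hgenP r; rewrite fE.
  apply: mulmx_ext => y; rewrite mulmxBl mul_scalar_mx.
  by have := barU b (map_mx abar y); rewrite map_mxM barK.
Qed.

End OperatorModel.

(** * The W-graph carried by an ideal *)
Section WGraphModule.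
Import GRing.Theory.
Local Open Scope ring_scope.

Lemma ascentP b w : (len w < len (g b * w)%g)%N ->
  exists c l, [/\ (l < m)%N, w = aw c l, b = c (+) odd l & (g b * w = aw c l.+1)%g].
Proof.
have [c [l [lm ->]]] := awordP w => up.
have lm' : (l < m)%N.
  move: lm up; rewrite leq_eqVlt => /orP[/eqP->|//].
  by rewrite len_top len_aword //; lia.
have [->|bn] := eqVneq b (c (+) odd l); first by exists c, l; rewrite aword_up.
have {bn} bE : b = c (+) ~~ odd l by case: b c bn {up} => [] []; case: odd.
case: l lm lm' up bE => [|l] lm lm' up bE.
  by exists (~~ c), 0%N; rewrite bE aword0 mulg1 aword1 addbT addbF.
by move: up; rewrite bE aword_down // !len_aword ?ltnNge ?leqnSn //; lia.
Qed.

Section WGraph.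
Variables I J : {set W}.
Hypothesis I1 : 1%g \in I.
Local Notation n := #|I|.-1.
Local Notation V := 'cV[laurent]_n.+1.

Definition wg_label (i : 'I_n.+1) : W := nth 1%g (enum I) i.
Definition wg_index (w : W) : 'I_n.+1 := inord (index w (enum I)).
(** For w outside I this is 0, so that the action below needs no special case at
    the boundary of I. *)
Definition wg_vec (w : W) : V := \col_i (wg_label i == w)%:R.
Local Notation c := wg_vec.

Lemma card_I : n.+1 = #|I|.
Proof. by rewrite prednK //; apply/card_gt0P; exists 1%g. Qed.

Lemma wg_label_in i : wg_label i \in I.
Proof.
by rewrite -mem_enum mem_nth // -cardE (leq_trans (ltn_ord i)) // card_I.
Qed.

Lemma wg_indexK w : w \in I -> wg_label (wg_index w) = w.
Proof.
move=> wI; rewrite /wg_label inordK ?nth_index ?mem_enum //.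
by rewrite card_I cardE index_mem mem_enum.
Qed.

Lemma wg_labelK i : wg_index (wg_label i) = i.
Proof.
apply: val_inj; rewrite /wg_index /wg_label index_uniq ?enum_uniq ?inord_val //.
by rewrite -cardE (leq_trans (ltn_ord i)) // card_I.
Qed.

Lemma wg_vec_out w : w \notin I -> c w = 0.
Proof.
move=> wI; apply/matrixP=> i j; rewrite !mxE.
by case: eqP wI => // <-; rewrite wg_label_in.
Qed.

Definition wg_coord (w : W) (x : V) : laurent := x (wg_index w) 0.

Lemma wg_coord_lin w a x y :
  wg_coord w (a *: x + y) = a * wg_coord w x + wg_coord w y.
Proof. by rewrite /wg_coord !mxE. Qed.

Lemma wg_coord_vec u w : u \in I -> w \in I -> wg_coord w (c u) = (u == w)%:R.
Proof. by move=> uI wI; rewrite /wg_coord mxE wg_indexK // eq_sym. Qed.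

Lemma wg_expand (x : V) : x = \sum_(w in I) wg_coord w x *: c w.
Proof.
apply/matrixP=> i j; rewrite ord1 summxE (bigD1 (wg_label i)) ?wg_label_in //=.
rewrite !mxE eqxx mulr1 /wg_coord wg_labelK big1 ?addr0 // => w /andP[_ /negPf wi].
by rewrite !mxE eq_sym wi mulr0.
Qed.

Lemma wg_ind (P : V -> Prop) : (forall a x y, P x -> P y -> P (a *: x + y)) ->
  P 0 -> (forall w, w \in I -> P (c w)) -> forall x, P x.
Proof.
move=> PD P0 Pc x; rewrite [x]wg_expand.
by elim/big_rec: _ => // w y wI Py; apply: PD => //; apply: Pc.
Qed.

(** Strong and weak descents of w. *)
Definition wg_desc (b : bool) (w : W) : bool :=
  (len (g b * w)%g < len w)%N || ((g b * w)%g \notin D S J).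

(** The W-graph has the elements of I as vertices and left multiplication by s
    and t as edges, all of weight 1. If b is not a descent of w, T_b - q sends w
    to the neighbours having b as a descent; b w is one of them, if it is in I. *)
Definition wg_image (b : bool) (w : W) : V :=
  if wg_desc b w then - qV *: c w
  else q *: c w + (c (g b * w)%g +
    (if wg_desc b (g (~~ b) * w)%g then c (g (~~ b) * w)%g else 0)).

Definition wg_mx (b : bool) : 'M[laurent]_n.+1 :=
  \matrix_(i, j) wg_image b (wg_label j) i 0.
Local Notation U := (fun b => [the {linear V -> V} of
  @mulmx laurent n.+1 n.+1 1 (wg_mx b)]).

Lemma wg_mxE b w : w \in I -> wg_mx b *m c w = wg_image b w.
Proof.
move=> wI; apply/matrixP=> i j; rewrite ord1 mxE (bigD1 (wg_index w)) //=.
rewrite !mxE wg_indexK // eqxx mulr1 big1 ?addr0 // => k kw.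
rewrite !mxE; case: eqP => [kE|]; last by rewrite mulr0.
by rewrite -kE wg_labelK eqxx in kw.
Qed.

Lemma wg_mx_desc b w : wg_desc b w -> wg_mx b *m c w = - qV *: c w.
Proof.
have [wI d|/wg_vec_out -> _] := boolP (w \in I); last by rewrite mulmx0 scaler0.
by rewrite wg_mxE // /wg_image d.
Qed.

(** Formal for any W-graph: the vertices with descent b span an eigenspace for
    -q^-1, and T_b - q maps into it. *)
Lemma wg_quad b (x : V) : wg_mx b *m (wg_mx b *m x) = x + xi *: (wg_mx b *m x).
Proof.
elim/wg_ind: x => /= [a x y IHx IHy||w wI].
- rewrite !mulmxDr -!scalemxAr IHx IHy !scalerDr !scalerA [xi * a]mulrC.
  by rewrite addrACA.
- by rewrite !mulmx0 scaler0 addr0.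
rewrite (wg_mxE _ wI) /wg_image; case: ifP => d.
  rewrite -scalemxAr wg_mx_desc // !scalerA.
  rewrite -[X in _ = X + _]scale1r -scalerDl.
  congr (_ *: _); rewrite /xi !mulrN mulNr mulrBl mulqV opprK.
  by rewrite opprB addrCA subrr addr0.
have {}d' : wg_desc b (g b * w)%g.
  by move: d; rewrite /wg_desc gen_eltK; have := len_genM b w; lia.
rewrite mulmxDr -scalemxAr (wg_mxE _ wI) /wg_image d mulmxDr wg_mx_desc //.
set y := if _ then _ else _.
have -> : wg_mx b *m y = - qV *: y.
  by rewrite /y; case: ifP => [/wg_mx_desc|_] //; rewrite mulmx0 scaler0.
rewrite -scalerDr; move: (c (g b * w)%g + y) => z.
rewrite !scalerDr -!addrA scaleNr -scalerBl -/xi !scalerA addrA; congr (_ + _).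
rewrite -[X in _ = X + _]scale1r -scalerDl; congr (_ *: _).
by rewrite /xi mulrBl Defs.mulVq addrC subrK.
Qed.

Lemma wg_vec_bar w : map_mx abar (c w) = c w.
Proof. by apply/matrixP=> i j; rewrite !mxE rmorph_nat. Qed.

(** The off-diagonal entries are integers, and both diagonal entries q and -q^-1
    satisfy bar a = a - (q - q^-1). *)
Lemma wg_bar b (x : V) : map_mx abar (wg_mx b *m x) =
  wg_mx b *m map_mx abar x - xi *: map_mx abar x.
Proof.
elim/wg_ind: x => /= [a x y IHx IHy||w wI].
- rewrite !mulmxDr -!scalemxAr !map_mxD !map_mxZ IHx IHy mulmxDr -scalemxAr.
  by rewrite scalerBr scalerDr !scalerA opprD addrACA [xi * _]mulrC.
- by rewrite !(mulmx0, map_mx0) scaler0 subr0.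
rewrite wg_vec_bar wg_mxE // /wg_image; case: ifP => _.
  rewrite map_mxZ wg_vec_bar rmorphN /= abar_qV -scalerBl; congr (_ *: _).
  by rewrite /xi opprB addKr.
rewrite !map_mxD map_mxZ !wg_vec_bar /= abar_q.
have -> d u : map_mx abar (if d then c u else 0) = if d then c u else 0.
  by case: d; rewrite ?wg_vec_bar ?map_mx0.
rewrite addrAC -scalerBl; congr (_ *: _ + _).
by rewrite /xi opprB addrCA subrr addr0.
Qed.

Local Notation e := (c 1%g).
(** T_w applied to the vertex 1. The longest element has two words, which agree
    on this vertex as soon as the braid relation does. *)
Definition word_vec (w : W) : V :=
  if w == aw true (len w) then opword U true (len w) e
  else opword U false (len w) e.

Section Words.
Hypothesis braid_e : opword U true m e = opword U false m e.

Lemma word_vecE b l : (l <= m)%N -> word_vec (aw b l) = opword U b l e.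
Proof.
move=> lm; rewrite /word_vec len_aword //; case: eqP => [/(aword_inj lm lm)[_]|].
  by case=> [->//|->//|->]; case: b.
by case: b.
Qed.

Hypothesis ideal_I : weak_ideal S I.
Hypothesis ID : I \subset D S J.
Hypothesis tri : forall b l, (l <= m)%N -> aw b l \in I ->
  exists2 x, cspan I len in_Zq c l x & opword U b l e = c (aw b l) + q *: x.
Hypothesis top_WD : forall b l, (l < m)%N -> aw b l \in I ->
  aw b l.+1 \notin D S J -> opword U b l.+1 e = - qV *: opword U b l e.
Hypothesis top_WA : forall b l, (l < m)%N -> aw b l \in I ->
  aw b l.+1 \in D S J -> aw b l.+1 \notin I ->
  exists2 x, cspan I len in_Zq c l.+1 x &
    opword U b l.+1 e = q *: opword U b l e - q *: x.

Lemma word_vec_tri w : w \in I ->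
  exists2 x, cspan I len in_Zq c (len w) x & word_vec w = c w + q *: x.
Proof.
have [b [l [lm ->]]] := awordP w => wI.
by rewrite len_aword // word_vecE //; apply: tri.
Qed.

Lemma word_vec_basis : is_basis I word_vec.
Proof.
apply: (triangular_basis wg_coord_lin wg_coord_vec) => [x|w wI].
  by exists (fun w => wg_coord w x); apply: wg_expand.
have [x sx ->] := word_vec_tri wI; exists x => //; exact: cspan_weaken sx.
Qed.

(** The vertex 1 generates the module, so [braid_stable] propagates the relation
    from it. *)
Lemma word_braid x : opword U true m x = opword U false m x.
Proof.
have [f ->] := word_vec_basis.1 x.
elim/big_rec: _ => [|w y wI IH].
  by rewrite -[0](scale0r 0) !opwordZ !scale0r.
rewrite !opwordD !opwordZ IH; congr (_ *: _ + _).
have [b [l [lm ->]]] := awordP w; rewrite word_vecE //.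
elim: l {lm} => [|l IHl] //=.
by apply: braid_stable => //; [apply: wg_quad | lia].
Qed.

(** The formulas for the action hold by construction where left multiplication
    stays inside I. What depends on the ideal is the braid relation on the vertex
    1, triangularity, and the action at the top of the two segments of I. *)
Lemma wgraph_of_words : wgraph_ideal S I J.
Proof.
have [_ closed_I] := (weak_idealP I).1 ideal_I.
apply: (@matrix_model_wgraph I J n wg_mx word_vec) => //; split.
- exact: wg_quad.
- exact: word_braid.
- exact: word_vec_basis.
- move=> b w wI rI lw; have [c' [l [lm wE bE rE]]] := ascentP lw.
  by rewrite rE wE !word_vecE // ?(ltnW lm) //= bE.
- move=> b w wI lw rD; have [c' [l [lm wE bE rE]]] := ascentP lw.
  rewrite wE !word_vecE // ?(ltnW lm) //= bE -top_WD -?wE -?rE //.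
- move=> b w wI lw rD rI; have [c' [l [lm wE bE rE]]] := ascentP lw.
  rewrite rE len_aword // wE word_vecE ?(ltnW lm) // bE.
  rewrite rE in rI rD; rewrite wE in wI; have [x sx xE] := @top_WA c' l lm wI rD rI.
  exists x => //; apply: (@cspan_triangular _ _ _ _ _ semiring_Zq c) => //.
  + exact: q_Zq.
  + exact: word_vec_tri.
  + exact: (intr_Zq (-1)).
- by move=> x y; rewrite map_mxD.
- by move=> a x; rewrite map_mxZ.
- by move=> x; apply/matrixP=> i j; rewrite !mxE [LHS]abarK.
- have -> : word_vec 1%g = e := word_vecE true (leq0n m).
  exact: wg_vec_bar.
- by move=> b x; rewrite /= wg_bar.
Qed.

End Words.

End WGraph.
End WGraphModule.

(** * Existence of the modules *)
Section Sufficiency.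
Import GRing.Theory.
Local Open Scope ring_scope.

(** A left ideal meets the words with a given last letter in an initial segment;
    h b is the greatest length for the letter b. *)
Definition has_heights (I : {set W}) (h : bool -> nat) : Prop :=
  forall b, (h b <= m)%N /\ forall i, (i <= m)%N -> (aw b i \in I) = (i <= h b)%N.

Section Heights.
Variables (I J : {set W}) (h : bool -> nat).
Hypothesis hI : has_heights I h.

Lemma heights_1 : 1%g \in I.
Proof. by rewrite -(aword0 true) (hI true).2. Qed.

Lemma heights_ideal : weak_ideal S I.
Proof.
apply/weak_idealP; split; first by apply/set0Pn; exists 1%g; apply: heights_1.
have down b l : (0 < l <= m)%N -> aw b l \in I -> aw b l.-1 \in I.
  by case/andP=> l0 lm; rewrite !(hI b).2 //; lia.
move=> b w; have [c [l [lm ->]]] := awordP w => wI.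
have [->|bn] := eqVneq b (c (+) odd l).
  move: lm wI; rewrite leq_eqVlt => /orP[/eqP->|lm] wI lw; last first.
    by move: lw; rewrite len_up // len_aword ?(ltnW lm) //; lia.
  move: wI; rewrite (aword_m c) => wI.
  have -> : c (+) odd m = ~~ c (+) ~~ odd m by rewrite addbN addNb negbK.
  by rewrite aword_down ?down //; lia.
have -> : b = c (+) ~~ odd l by case: b c bn {wI} => [] []; case: odd.
case: l lm bn wI => [|l] lm _ wI; last by rewrite aword_down // => _; apply: down wI.
by rewrite mulg1 len_gen len1.
Qed.

Local Notation n := #|I|.-1.
Local Notation V := 'cV[laurent]_n.+1.
Local Notation c := (wg_vec I).
Local Notation e := (c 1%g).
Local Notation U := (fun b => [the {linear V -> V} of
  @mulmx laurent n.+1 n.+1 1 (wg_mx I J b)]).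
Local Notation desc := (wg_desc J).

Lemma klop_vec b w : w \in I -> ~~ desc b w -> klop U b (c w) =
  c (g b * w)%g + (if desc b (g (~~ b) * w)%g then c (g (~~ b) * w)%g else 0).
Proof.
move=> wI d; rewrite /klop /= (wg_mxE _ heights_1 _ wI) /wg_image (negPf d).
by rewrite addrAC subrr add0r.
Qed.

Lemma not_desc b l : (l < m)%N -> aw b l.+1 \in D S J ->
  ~~ desc (b (+) odd l) (aw b l).
Proof.
move=> lm lD; rewrite /wg_desc aword_up lD orbF !len_aword ?(ltnW lm) //.
by rewrite -leqNgt.
Qed.

(** The neighbour above has the letter as a descent. So has the neighbour below,
    except when it is 1 and the letter is not a weak descent of it. *)
Lemma klop_path b l : (0 < l < m)%N -> aw b l \in I -> aw b l.+1 \in D S J ->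
  klop U (b (+) odd l) (c (aw b l)) = c (aw b l.+1) +
    (if (1 < l)%N || (g (~~ b) \notin D S J) then c (aw b l.-1) else 0).
Proof.
case/andP=> l0 lm lI lD.
have dE : desc (b (+) odd l) (aw b l.-1) = (1 < l)%N || (g (~~ b) \notin D S J).
  case: l l0 lm {lI lD} => [|[|l]] // _ lm; last first.
    have /= := aword_down b (ltn0Sn l); rewrite /= negbK /wg_desc => ->.
    by rewrite !len_aword ?ltnSn //; lia.
  by rewrite /wg_desc /= addbT aword0 mulg1 len_gen len1.
rewrite klop_vec // ?not_desc // aword_up -addbN aword_down //.
by rewrite dE.
Qed.

Lemma klop_one b : g b \in D S J -> (g (~~ b) \in I -> ~~ desc b (g (~~ b))) ->
  klop U b e = c (g b).
Proof.
move=> bD nd; rewrite -(aword0 b) -{1}[b]addbF klop_vec.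
- rewrite aword0 !mulg1 /= addbF; case: ifP => d; last by rewrite addr0.
  by rewrite [c (g (~~ b))]wg_vec_out ?addr0 // ?heights_1 //; apply: contraL d.
- by rewrite aword0 heights_1.
- by apply: (@not_desc b 0); rewrite ?aword1 // ltnW.
Qed.

End Heights.

Section Regular.
Variables (I : {set W}) (h : bool -> nat).
Hypothesis hI : has_heights I h.
Hypothesis h_dvd : forall b, (h b < m)%N -> ((h b).+1 %| m)%N.
Local Notation n := #|I|.-1.
Local Notation V := 'cV[laurent]_n.+1.
Local Notation c := (wg_vec I).
Local Notation e := (c 1%g).
Local Notation U := (fun b => [the {linear V -> V} of
  @mulmx laurent n.+1 n.+1 1 (wg_mx I set0 b)]).
Local Notation Q := (side_seq U e).
Local Notation desc := (wg_desc set0).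
Let quad b (x : V) : U b (U b x) = x + xi *: U b x := wg_quad set0 (heights_1 hI) b x.
Let inD0 w : w \in D S set0. Proof. by rewrite D_none inE. Qed.

(** As long as it stays in I, the path on the side b runs through the vertices of
    the W-graph; the vertex 1 is a source, which accounts for Q b 0 = 0. *)
Lemma side_vec b l : (l <= h b)%N -> (l < m)%N -> Q b l.+1 = c (aw b l.+1).
Proof.
suff : ((l <= h b)%N -> (l < m)%N -> Q b l.+1 = c (aw b l.+1)) /\
   ((l.+1 <= h b)%N -> (l.+1 < m)%N -> Q b l.+2 = c (aw b l.+2)) by case.
have I1 := heights_1 hI; have up i : (i <= h b)%N -> (i <= m)%N -> aw b i \in I.
  by move=> ih im; rewrite (hI b).2.
have Q1 : Q b 1 = c (aw b 1).
  rewrite [LHS](klop_one hI) ?aword1 // => _.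
  have -> : desc b (g (~~ b)) = (len (aw (~~ b) 2) < len (aw (~~ b) 1))%N.
    by rewrite /wg_desc inD0 orbF awordS aword1 addbT negbK.
  by rewrite !len_aword // ltnW.
have step i : (i < h b)%N -> (i.+1 < m)%N -> Q b i.+1 = c (aw b i.+1) ->
    (if (0 < i)%N then c (aw b i) else 0) = Q b i -> Q b i.+2 = c (aw b i.+2).
  move=> ih im QS Qi; rewrite [LHS]path_seqSS -/(Q b i.+1) -/(Q b i) QS.
  rewrite (_ : ~~ b (+) odd i = b (+) odd i.+1); last by rewrite /= addbN addNb.
  by rewrite (klop_path hI) ?up ?(ltnW im) // inD0 orbF /= Qi addrK.
elim: l => [|l [IH1 IH2]]; first by split=> [_ _|lh lm]; [exact: Q1 | exact: step].
split=> [|lh lm]; first exact: IH2.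
by apply: step => //; [apply: IH2; lia | rewrite IH1 //; lia].
Qed.

Lemma side_top b : (h b < m)%N -> Q b (h b).+1 = 0.
Proof.
by move=> hm; rewrite side_vec // wg_vec_out // ?(heights_1 hI) // (hI b).2 // ltnn.
Qed.

(** Beyond the top of its segment, the path is folded back onto it. *)
Lemma side_lattice b l : (l <= m)%N -> cspan I len in_Zq c l.+1 (Q b l).
Proof.
move=> lm; have c_span i : (0 < i <= h b)%N -> (i <= l)%N ->
    cspan I len in_Zq c l.+1 (Q b i).
  case: i => // i ih il; rewrite side_vec; try lia.
  have im : (i.+1 <= m)%N by lia.
  by apply: (cspan_mem semiring_Zq); rewrite ?(hI b).2 ?len_aword.
have [hm|hm] := ltnP (h b) m; last first.
  case: l lm c_span => [|l] lm c_span; first exact: (cspan0 _ _ semiring_Zq).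
  by apply: c_span; lia.
have [P0 Pi] := path_folding (ltn0Sn (h b)) (side_top hm) l.
have [/P0|/Pi[i ih]] := boolP ((h b).+1 %| l)%N.
  by rewrite -/(Q b l) => ->; apply: (cspan0 _ _ semiring_Zq).
rewrite -/(Q b l) -/(Q b i); case=> ->; first by apply: c_span; lia.
rewrite -scaleN1r; apply: (cspanZ semiring_Zq); last by apply: c_span; lia.
exact: (intr_Zq (-1)).
Qed.

Lemma regular_opword b l : (l < m)%N -> exists2 x, cspan I len in_Zq c l.+1 x &
  opword U b l.+1 e = Q b l.+1 + q *: x.
Proof.
move=> lm; exists (opword U b l e + Q (~~ b) l); last exact: opword_lead.
apply: (cspanD semiring_Zq); last by apply: side_lattice; lia.
elim: l lm => [|l IH] lm.
  by apply: (cspan_mem semiring_Zq); rewrite ?(heights_1 hI) // len1.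
rewrite opword_lead //; apply: (cspanD semiring_Zq).
  by apply: side_lattice; lia.
apply: (cspanZ semiring_Zq q_Zq); apply: (cspan_mono semiring_Zq (leqnSn _)).
by apply: (cspanD semiring_Zq); [apply: IH; lia | apply: side_lattice; lia].
Qed.

(** Both paths reach the vector of the longest element at the index m: inside W
    when I = W, and otherwise because that vector is 0 and, by divisibility, m
    is folded onto 0. *)
Lemma wgraph_regular : wgraph_ideal S I set0.
Proof.
have I1 := heights_1 hI.
apply: (wgraph_of_words I1).
- apply/(opword_commute quad).
  have top b : (h b < m)%N -> Q b m = 0.
    move=> hm; apply: (path_folding (ltn0Sn (h b)) (side_top hm) m).1.
    exact: h_dvd.
  have top' b : Q b m = c (aw true m).
    have [hm|hm] := ltnP (h b) m.
      rewrite top // wg_vec_out //; case: b hm => hm.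
        by rewrite (hI true).2 // -ltnNge.
      by rewrite (aword_m true) (hI false).2 // -ltnNge.
    have := @side_vec b m.-1; rewrite (@prednK m) ?(ltnW m_ge2) // => ->; try lia.
    by case: b {hm} => //; rewrite (aword_m true).
  by rewrite !top'.
- exact: heights_ideal.
- by apply/subsetP=> w _.
- move=> b [|l] lm lI.
    by exists 0; [apply: (cspan0 _ _ semiring_Zq) | rewrite scaler0 addr0].
  have lh : (l.+1 <= h b)%N by rewrite -(hI b).2.
  have [x sx ->] := regular_opword b lm; exists x => //.
  by rewrite side_vec // ltnW.
- by move=> b l _ _; rewrite inD0.
- move=> b l lm lI _ lI'; exists (- Q (~~ b) l).
    rewrite -scaleN1r; apply: (cspanZ semiring_Zq (intr_Zq (-1))).
    by apply: side_lattice; lia.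
  move: lI lI'; rewrite !(hI b).2 ?(ltnW lm) // -ltnNge => lI lI'.
  have hl : h b = l by lia.
  have := side_top (b := b); rewrite hl => /(_ lm) Q0.
  by rewrite opword_lead // Q0 add0r scalerDr scalerN opprK.
Qed.

End Regular.
Section OneSided.
Variables (I : {set W}) (h : bool -> nat) (b0 : bool).
Hypothesis hI : has_heights I h.
Hypothesis h_other : h (~~ b0) = 0%N.
Hypothesis h_lt : (h b0 < m)%N.
Hypothesis h_dvd : ((h b0).+1 < m)%N -> ((h b0).+2 %| m)%N.
Local Notation J := [set g (~~ b0)].
Local Notation n := #|I|.-1.
Local Notation V := 'cV[laurent]_n.+1.
Local Notation c := (wg_vec I).
Local Notation e := (c 1%g).
Local Notation U := (fun b => [the {linear V -> V} of
  @mulmx laurent n.+1 n.+1 1 (wg_mx I J b)]).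
Local Notation P := (path_seq U b0 e).
Local Notation desc := (wg_desc J).
Let quad b (x : V) : U b (U b x) = x + xi *: U b x := wg_quad J (heights_1 hI) b x.

Let one_sided b l : (l <= m)%N -> aw b l \in I -> l = 0%N \/ b = b0 /\ (l <= h b0)%N.
Proof.
move=> lm; rewrite (hI b).2 //; have [->|bb] := eqVneq b b0; first by right.
have -> : b = ~~ b0 by case: b b0 bb => [] [].
by rewrite h_other leqn0 => /eqP; left.
Qed.

Let gD : g (~~ b0) \notin D S J.
Proof.
by have := mem_D1 b0 (~~ b0) (ltnW m_ge2); rewrite aword1 => ->; case: b0.
Qed.

Let P_start : U (~~ b0) e = - qV *: e.
Proof. by apply: (wg_mx_desc (heights_1 hI)); rewrite /wg_desc mulg1 gD orbT. Qed.

(** With a weak descent at the vertex 1, the path may start there rather than at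
    its neighbour: all indices are shifted by one. *)
Lemma path_vec l : (l <= (h b0).+1)%N -> (l < m)%N -> P l.+1 = c (aw b0 l).
Proof.
suff : ((l <= (h b0).+1)%N -> (l < m)%N -> P l.+1 = c (aw b0 l)) /\
   ((l.+1 <= (h b0).+1)%N -> (l.+1 < m)%N -> P l.+2 = c (aw b0 l.+1)) by case.
have up i : (i <= h b0)%N -> (i < m)%N -> aw b0 i \in I.
  by move=> ih im; rewrite (hI b0).2 // ltnW.
have inD i : (i < m)%N -> aw b0 i \in D S J.
  by move=> im; rewrite mem_D1 ?(ltnW im) // eqxx im orbT.
elim: l => [|l [IH1 IH2]].
  split=> // _ m1; rewrite [LHS]path_seqSS subr0 addbF (klop_one hI) ?aword1 //.
    by rewrite -(aword1 b0) inD.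
  by rewrite -(aword1 (~~ b0)) (hI (~~ b0)).2 ?(ltnW m1) // h_other.
split=> [|lh lm]; first exact: IH2.
rewrite path_seqSS IH2 ?IH1; try lia.
by rewrite (klop_path hI) ?up ?inD ?gD ?orbT ?addrK //; lia.
Qed.

Lemma path_lattice l : (l <= h b0)%N -> cspan I len in_Zq c l (P l).
Proof.
case: l => [|l] lh; first exact: (cspan0 _ _ semiring_Zq).
rewrite path_vec; try lia.
by apply: (cspan_mem semiring_Zq); rewrite ?(hI b0).2 ?len_aword; lia.
Qed.

(** When I is the whole of D_J, the last vertex of the path has both letters as
    descents, one of them weak. *)
Lemma opword_top : (h b0).+1 = m -> opword U b0 m e = - qV *: opword U b0 m.-1 e.
Proof.
move=> hm; rewrite -hm -[(h b0).+1.-1]/(h b0) -[LHS]/(U _ (opword U b0 (h b0) e)).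
rewrite (opword_path quad P_start) linearD linearZ (path_desc quad P_start).
rewrite path_vec // /= wg_mx_desc ?(heights_1 hI) //.
  by rewrite scalerDr !scalerA mulrC.
rewrite /wg_desc aword_up hm mem_D1 // ltnn andbF orbF; apply/orP; right.
by case: (m) m_ge2.
Qed.

Lemma wgraph_one_sided : wgraph_ideal S I J.
Proof.
have I1 := heights_1 hI; have m0 := ltnW m_ge2.
have P_top : ((h b0).+1 < m)%N -> P (h b0).+2 = 0.
  move=> hm; rewrite path_vec ?leqnn // wg_vec_out // (hI b0).2 ?ltnn //.
apply: (wgraph_of_words I1).
- suff E : opword U b0 m e = opword U (~~ b0) m e by case: b0 E.
  rewrite -[X in opword _ (~~ b0) X](prednK m0) opwordSr negbK P_start opwordZ.
  (* The second word starts with a letter acting on e by -q^-1. *)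
  have [hm|hm] := ltnP (h b0).+1 m; last by apply: opword_top; lia.
  rewrite !(opword_path quad P_start) (prednK m0).
  have Pm : P m = 0 by apply: (path_folding (ltn0Sn _) (P_top hm) m).1; apply: h_dvd.
  rewrite -[in P m.+1](prednK m0) path_seqSS (prednK m0) Pm /klop !linear0.
  rewrite /= !(scaler0, subr0, sub0r, add0r, addr0).
  by rewrite scalerA mulNr Defs.mulVq scaleN1r.
- exact: heights_ideal.
- apply/subsetP=> w; have [b [l [lm ->]]] := awordP w => wI.
  by rewrite mem_D1 //; have [->|[-> lh]] := one_sided lm wI; rewrite ?eqxx; lia.
- move=> b [|l] lm lI.
    by exists 0; [apply: (cspan0 _ _ semiring_Zq) | rewrite scaler0 addr0].
  have [//|[bE lh]] := one_sided lm lI; exists (P l.+1).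
    exact: path_lattice.
  rewrite bE (opword_path quad P_start) path_vec ?(leqW lh) //.
  exact: leq_ltn_trans h_lt.
- move=> b l lm lI; have [l0|[bE lh]] := one_sided (ltnW lm) lI.
    rewrite l0 aword1 /= addbF; have [->|bb] := eqVneq b (~~ b0); first by [].
    have -> : b = b0 by case: b b0 bb {lI} => [] [].
    by rewrite -aword1 mem_D1 ?eqxx //; lia.
  rewrite bE => lD; have lE : l.+1 = m.
    by move: lD; rewrite mem_D1 // eqxx /=; lia.
  by have := opword_top; rewrite -lE; apply; lia.
- move=> b l lm lI lD lI'.
  have bE : b = b0.
    have [//|bb] := eqVneq b b0; move: lD; rewrite mem_D1 //= (negPf bb) //.
  have hl : h b0 = l.
    by move: lI lI'; rewrite bE !(hI b0).2 ?(ltnW lm) // -ltnNge; lia.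
  have hm : ((h b0).+1 < m)%N by move: lD; rewrite bE mem_D1 // eqxx -hl.
  rewrite bE -hl; exists (q *: P (h b0)).
    apply: (cspanZ semiring_Zq q_Zq); apply: (cspan_mono semiring_Zq (leqnSn _)).
    exact: path_lattice.
  rewrite !(opword_path quad P_start) P_top // add0r scalerDr addrK.
  by [].
Qed.

End OneSided.
End Sufficiency.

(** * Divisibility forced by the module *)
Section Necessity.
Import GRing.Theory.
Local Open Scope ring_scope.

Lemma heights_trivial : has_heights [set 1%g] (fun _ => 0%N).
Proof.
move=> b; split=> // i im; rewrite inE leqn0; apply/eqP/eqP => [e1|->] //.
by have [] := @aword_inj b b i 0%N im isT e1.
Qed.

(** In rank one, both generators act by -q^-1. *)
Lemma wgraph_trivial : wgraph_ideal S [set 1%g] S.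
Proof.
have hI := heights_trivial; have I1 := heights_1 hI.
pose U b := [the {linear 'cV[laurent]_(#|[set 1%g : W]|.-1.+1) -> _} of
  @mulmx laurent _ _ 1 (wg_mx [set 1%g] S b)].
have gD b : g b \notin D S S.
  by rewrite D_all inE -aword1; apply/eqP => /(@aword_inj b b 1 0 (ltnW m_ge2) isT)[].
have Ue b : U b (wg_vec [set 1%g] 1%g) = - qV *: wg_vec [set 1%g] 1%g.
  by apply: (wg_mx_desc I1); rewrite /wg_desc mulg1 gD orbT.
have opE b l : opword U b l (wg_vec [set 1%g] 1%g) =
    (- qV) ^+ l *: wg_vec [set 1%g] 1%g.
  elim: l => [|l IH]; first by rewrite scale1r.
  by rewrite [LHS]/= IH linearZZ Ue scalerA exprSr.
have l0 b l : (l <= m)%N -> aw b l \in [set 1%g] -> l = 0%N.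
  by move=> lm; rewrite (hI b).2 // leqn0 => /eqP.
apply: (wgraph_of_words I1).
- by rewrite [LHS]opE [RHS]opE.
- exact: (heights_ideal hI).
- by rewrite D_all.
- move=> b l lm /(l0 _ _ lm) ->; exists 0; first exact: (cspan0 _ _ semiring_Zq).
  by rewrite scaler0 addr0.
- by move=> b l lm lI _; rewrite [LHS]opE [in RHS]opE exprS scalerA.
- by move=> b l lm /(l0 _ _ (ltnW lm)) ->; rewrite aword1 (negPf (gD b)).
Qed.

Section FromModel.
Variables (I J : {set W}) (h : bool -> nat).
Hypothesis hI : has_heights I h.
Variables (V : lmodType laurent) (U : bool -> {linear V -> V}) (v : W -> V)
  (bar : V -> V).
Hypothesis model : ideal_model I J U v bar.
Local Notation e := (v 1%g).
Local Notation Zspan := (cspan I len in_Zq v).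
Local Notation Aspan := (cspan I len (fun _ => True) v).
Let quad := model_quad model.
Let closed_I := ((weak_idealP I).1 (heights_ideal hI)).2.

Lemma model_opword b l : (l <= m)%N -> (l <= h b)%N -> opword U b l e = v (aw b l).
Proof.
elim: l => [|l IH] lm lh; first by rewrite aword0.
rewrite [LHS]/= IH ?(ltnW lm) ?(ltnW lh) // (model_up model) ?aword_up //.
- by rewrite (hI b).2 ltnW.
- by rewrite (hI b).2.
- by rewrite !len_aword // ltnW.
Qed.

Lemma model_down b w : w \in I -> (len (g b * w)%g < len w)%N ->
  U b (v w) = v (g b * w)%g + xi *: v w.
Proof.
move=> wI lw; have gI := closed_I wI lw.
have vE : U b (v (g b * w)%g) = v w by rewrite (model_up model) ?gen_eltK.
by rewrite -{1}vE quad vE.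
Qed.

(** In each of the four cases of the action, only elements of length at most one
    more occur. *)
Lemma model_filtration b l x : Aspan l x -> Aspan l.+1 (U b x).
Proof.
case=> c [_ ->]; rewrite linear_sum; apply: (cspan_sum semiring_true) => w /andP[wI lw].
rewrite linearZ; apply: (cspanZ semiring_true) => //.
have v_span : Aspan l.+1 (v w) by apply: (cspan_mem semiring_true) => //; apply: ltnW.
have [lg|lg] := ltnP (len (g b * w)%g) (len w).
  rewrite model_down //; apply: (cspanD semiring_true).
    by apply: (cspan_mem semiring_true); [apply: closed_I | lia].
  exact: (cspanZ semiring_true).
have {}lg : len (g b * w)%g = (len w).+1 by have := len_genM b w; lia.
have [gI|gI] := boolP ((g b * w)%g \in I).
  by rewrite (model_up model) ?lg //; apply: (cspan_mem semiring_true) => //; lia.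
have [gD|gD] := boolP ((g b * w)%g \in D S J); last first.
  by rewrite (model_WD model) ?lg //; apply: (cspanZ semiring_true).
have [|y sy ->] := model_WA model wI _ gD gI; first by rewrite lg.
rewrite -scaleNr; apply: (cspanD semiring_true); apply: (cspanZ semiring_true) => //.
apply: (@cspan_mono _ _ _ _ _ semiring_true _ (len w).+1); first by lia.
by rewrite -lg; apply: cspan_weaken sy.
Qed.

(** By induction along the word, as bar (T_b x) = T_b (bar x) - (q - q^-1) bar x
    and T_b raises the filtration by at most one. *)
Lemma model_bar_triangular w : w \in I ->
  exists2 x, Aspan (len w) x & bar (v w) = v w + x.
Proof.
have [b [l [lm ->]]] := awordP w => wI; rewrite len_aword //.
have {wI} : (l <= h b)%N by rewrite -(hI b).2.
elim: l lm => [|l IH] lm lh.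
  by exists 0; [apply: (cspan0 _ _ semiring_true) | rewrite (model_bar1 model) addr0].
have [x sx bx] := IH (ltnW lm) (ltnW lh).
have vE : v (aw b l.+1) = U (b (+) odd l) (v (aw b l)).
  by rewrite -!model_opword // ltnW.
exists (U (b (+) odd l) x + (- xi *: v (aw b l) + - xi *: x)).
  apply: (cspanD semiring_true); first exact: model_filtration.
  apply: (cspanD semiring_true); apply: (cspanZ semiring_true) => //.
    apply: (cspan_mem semiring_true);
      by rewrite ?(hI b).2 ?len_aword ?(ltnW lm) ?(ltnW lh).
  exact: (cspan_mono semiring_true (leqnSn _)).
by rewrite vE (model_barU model) bx linearD -scalerDr scaleNr addrA.
Qed.

Lemma model_bar_klop b x : bar x = x -> bar (klop U b x) = klop U b x.
Proof.
move=> bx; rewrite /klop -[in LHS]scaleNr (model_barD model) (model_barU model).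
rewrite (model_barZ model) bx rmorphN /= abar_q -addrA -!scaleNr -scalerDl.
by congr (_ + _ *: _); rewrite /xi opprB addrAC subrr add0r.
Qed.

Lemma model_bar_path b z n : bar z = z -> bar (path_seq U b z n) = path_seq U b z n.
Proof.
have bar0 : bar 0 = 0 by have := model_barZ model 0 0; rewrite !scale0r rmorph0 scale0r.
move=> bz; suff : bar (path_seq U b z n) = path_seq U b z n /\
  bar (path_seq U b z n.+1) = path_seq U b z n.+1 by case.
elim: n => [|n [IH1 IH2]]; first by [].
split=> //; rewrite !path_seqSS (model_barD model) model_bar_klop //.
by rewrite -scaleN1r (model_barZ model) rmorphN rmorph1 IH1.
Qed.

Lemma model_unique l x : Zspan l x -> bar (q *: x) = q *: x -> x = 0.
Proof.
have [kap [kap_lin kap_v]] := basis_coordinates (model_basis model).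
exact: (bar_fixed_eq0 kap_lin kap_v (model_barD model) (model_barZ model)
  model_bar_triangular).
Qed.

Lemma model_top b l : (l < m)%N -> aw b l \in I -> aw b l.+1 \in D S J ->
  aw b l.+1 \notin I -> exists2 x, Zspan l.+1 x &
    opword U b l.+1 e = q *: opword U b l e - q *: x.
Proof.
move=> lm lI lD lI'; have lh : (l <= h b)%N by rewrite -(hI b).2 // ltnW.
have := model_WA model (b := b (+) odd l) lI.
rewrite aword_up !len_aword ?(ltnW lm) // => /(_ (leqnn _) lD lI')[x sx xE].
by exists x => //; rewrite [LHS]/= !model_opword // ltnW.
Qed.

End FromModel.

Section Regular.
Variables (I : {set W}) (h : bool -> nat).
Hypothesis hI : has_heights I h.
Hypothesis h_lt : forall b, (h b < m)%N.
Variables (V : lmodType laurent) (U : bool -> {linear V -> V}) (v : W -> V)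
  (bar : V -> V).
Hypothesis model : ideal_model I set0 U v bar.
Local Notation e := (v 1%g).
Local Notation Q := (side_seq U e).
Local Notation Zspan := (cspan I len in_Zq v).
Let quad := model_quad model.
Let inI b l : (l <= h b)%N -> aw b l \in I.
Proof. by move=> lh; rewrite (hI b).2 // (leq_trans lh) // ltnW. Qed.
Let opE b l : (l <= h b)%N -> opword U b l e = v (aw b l).
Proof. by move=> lh; rewrite (model_opword hI model) // (leq_trans lh) // ltnW. Qed.
Let v_span b l : (l <= h b)%N -> Zspan l.+1 (v (aw b l)).
Proof.
move=> lh; apply: (cspan_mem semiring_Zq); first exact: inI.
by rewrite len_aword // (leq_trans lh) // ltnW.
Qed.

Lemma side_step b l : Q b l.+1 = opword U b l.+1 e - q *: (opword U b l e + Q (~~ b) l).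
Proof. by rewrite opword_lead // addrK. Qed.

(** At the top of its segment, Q b is in q times the lattice: so is
    T_r b_w for the weak ascent r there, and [opword_lead] does the rest. Being
    invariant under bar, Q b vanishes, by [model_unique]. The two claims have to be
    proved together, by induction on l for both sides at once: the computation on
    one side involves the other path, perhaps beyond its own top, and that path
    stays in the lattice because the vanishing already obtained folds it. *)
Lemma model_side l b : Zspan l.+1 (Q b l) /\ (l = (h b).+1 -> Q b l = 0).
Proof.
elim/ltn_ind: l b => -[_ b|l IH b].
  by split=> //; apply: (cspan0 _ _ semiring_Zq).
have IHl := (IH l (ltnSn l) (~~ b)).1.
have zero : l.+1 = (h b).+1 -> Q b l.+1 = 0.
  case=> lh; have lm : (l < m)%N by rewrite lh.
  have lI : aw b l \in I by apply: inI; rewrite lh.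
  have lI' : aw b l.+1 \notin I by rewrite (hI b).2 // -ltnNge lh.
  have lD : aw b l.+1 \in D S set0 by rewrite D_none inE.
  have [x sx xE] := model_top hI model lm lI lD lI'.
  have QE : Q b l.+1 = q *: (-1 *: (x + Q (~~ b) l)).
    rewrite side_step xE scalerA mulrN1 scaleNr !scalerDr.
    by rewrite !opprD addrACA subrr add0r.
  rewrite QE (_ : -1 *: (x + Q (~~ b) l) = 0) ?scaler0 //.
  apply: (model_unique hI model (l := l.+1)).
    apply: (cspanZ semiring_Zq (intr_Zq (-1))).
    exact: (cspanD semiring_Zq).
  rewrite -QE; apply: (model_bar_path model); apply: (model_bar_klop model).
  exact: model_bar1 model.
split=> //; have [lh|] := leqP l.+1 (h b).
  rewrite side_step opE // -scaleNr; apply: (cspanD semiring_Zq); first exact: v_span.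
  apply: (cspanZ semiring_Zq (in_ZqN q_Zq)).
  apply: (cspan_mono semiring_Zq (leqnSn _)); apply: (cspanD semiring_Zq) => //.
  by rewrite opE ?(ltnW lh) //; apply: v_span; apply: ltnW.
rewrite leq_eqVlt => /orP[/eqP [/esym lh]|lh].
  by rewrite zero //; [apply: (cspan0 _ _ semiring_Zq) | lia].
have Q0 := (IH _ lh b).2 erefl.
have [P0 Pi] := path_folding (ltn0Sn (h b)) Q0 l.+1.
have [/P0|/Pi[i ih]] := boolP ((h b).+1 %| l.+1)%N.
  by rewrite -/(Q b l.+1) => ->; apply: (cspan0 _ _ semiring_Zq).
have Qi : Zspan l.+2 (Q b i).
  apply: (@cspan_mono _ _ _ _ _ semiring_Zq _ i.+1); first by lia.
  by apply: (IH i _ b).1; lia.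
rewrite -/(Q b l.+1) -/(Q b i); case=> -> //.
by rewrite -scaleN1r; apply: (cspanZ semiring_Zq (intr_Zq (-1))).
Qed.

(** By the braid relation the two paths meet at the index m. Each path has one of
    the letters as a descent there, so the common value is a double descent. *)
Lemma regular_dvd b : ((h b).+1 %| m)%N.
Proof.
have [kap [kap_lin kap_v]] := basis_coordinates (model_basis model).
have kap_low := @kap_span0 _ _ len _ _ _ kap_lin kap_v in_Zq.
have Q0 := (model_side (h b).+1 b).2 erefl.
have Qm c : Q c m = Q b m.
  have E : Q true m = Q false m.
    by apply/(opword_commute quad); apply: model_braid model e.
  by case: (b) (c) => [] []; rewrite ?E.
apply: (path_double_descent (kap := fun i => kap (aw b i)) _ (ltn0Sn _) Q0).
- by move=> i a x y; apply: kap_lin.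
- move=> [//|i] /andP[_]; rewrite ltnS => ih.
  rewrite -/(Q b i.+1) side_step opE //.
  have lam : (i.+1 <= m)%N by have := h_lt b; lia.
  rewrite -scaleNr addrC kap_lin kap_v ?inI // eqxx.
  rewrite (kap_low _ i.+1) ?mulr0 ?add0r ?inI //.
    by rewrite len_aword.
  apply: (cspanD semiring_Zq); last exact: (model_side i (~~ b)).1.
  by rewrite opE ?(ltnW ih) //; apply: v_span; apply: ltnW.
- move=> i j /andP[ji]; rewrite ltnS => ih.
  apply: (kap_low _ j.+1); first exact: inI.
    by rewrite len_aword // (leq_trans ih) // ltnW.
  exact: (model_side j b).1.
move=> c; rewrite -/(Q b m) -(Qm (~~ (c (+) odd m))).
have := path_desc quad (side_start quad e (~~ (c (+) odd m))) m.
by rewrite -/(Q _ m) negbK addbK.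
Qed.

End Regular.

Section OneSided.
Variables (I : {set W}) (h : bool -> nat) (b0 : bool).
Hypothesis hI : has_heights I h.
Hypothesis h_lt : ((h b0).+1 < m)%N.
Local Notation J := [set g (~~ b0)].
Variables (V : lmodType laurent) (U : bool -> {linear V -> V}) (v : W -> V)
  (bar : V -> V).
Hypothesis model : ideal_model I J U v bar.
Local Notation e := (v 1%g).
Local Notation P := (path_seq U b0 e).
Local Notation Zspan := (cspan I len in_Zq v).
Let quad := model_quad model.
Let h_ltm l : (l <= h b0)%N -> (l < m)%N.
Proof. by move=> lh; rewrite (leq_trans _ h_lt) // ltnS leqW. Qed.
Let inI l : (l <= h b0)%N -> aw b0 l \in I.
Proof. by move=> lh; rewrite (hI b0).2 // ltnW // h_ltm. Qed.
Let opE l : (l <= h b0)%N -> opword U b0 l e = v (aw b0 l).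
Proof. by move=> lh; rewrite (model_opword hI model) // ltnW // h_ltm. Qed.

Let P_start : U (~~ b0) e = - qV *: e.
Proof.
apply: (model_WD model); first exact: heights_1 hI.
  by rewrite mulg1 len_gen len1.
by have := mem_D1 b0 (~~ b0) (ltnW m_ge2); rewrite mulg1 aword1 => ->; case: b0.
Qed.

Lemma path_step l : P l.+1 = opword U b0 l e - q *: P l.
Proof. by rewrite (opword_path quad P_start) addrK. Qed.

Lemma model_path l : (l <= (h b0).+1)%N -> Zspan l (P l).
Proof.
elim: l => [|l IH] lh; first exact: (cspan0 _ _ semiring_Zq).
rewrite path_step -scaleNr; apply: (cspanD semiring_Zq).
  rewrite opE //; apply: (cspan_mem semiring_Zq); first exact: inI.
  by rewrite len_aword // ltnW // h_ltm.
apply: (cspanZ semiring_Zq (in_ZqN q_Zq)); apply: (cspan_mono semiring_Zq (leqnSn l)).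
by apply: IH; apply: ltnW.
Qed.

(** The analogue of [model_side] for a single path. *)
Lemma model_path_top : P (h b0).+2 = 0.
Proof.
have lm := h_ltm (leqnn _).
have lI' : aw b0 (h b0).+1 \notin I by rewrite (hI b0).2 // ltnn.
have lD : aw b0 (h b0).+1 \in D S J by rewrite mem_D1 // eqxx h_lt orbT.
have [x sx xE] := model_top hI model lm (inI (leqnn _)) lD lI'.
have PE : P (h b0).+2 = q *: (q *: P (h b0) + -1 *: x).
  rewrite path_step xE (opword_path quad P_start (h b0)) scaleN1r !scalerDr scalerN.
  by rewrite addrAC [X in X - _ - _]addrC addrK.
rewrite PE (_ : _ + _ = 0) ?scaler0 //.
apply: (model_unique hI model (l := (h b0).+1)).
  apply: (cspanD semiring_Zq).
    apply: (cspanZ semiring_Zq q_Zq); apply: (cspan_mono semiring_Zq (leqnSn _)).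
    exact: model_path.
  exact: (cspanZ semiring_Zq (intr_Zq (-1))).
by rewrite -PE; apply: (model_bar_path model); apply: model_bar1 model.
Qed.

(** One letter is a descent of P m in any case. The braid relation applied to e,
    on which one generator acts by -q^-1, says that the other is one too. *)
Lemma one_sided_dvd : ((h b0).+2 %| m)%N.
Proof.
have [kap [kap_lin kap_v]] := basis_coordinates (model_basis model).
have kap_low := @kap_span0 _ _ len _ _ _ kap_lin kap_v in_Zq.
apply: (path_double_descent (kap := fun i => kap (aw b0 i.-1)) _ (ltn0Sn _)
  model_path_top).
- by move=> i a x y; apply: kap_lin.
- move=> [//|i] /andP[_]; rewrite !ltnS => ih.
  rewrite path_step opE // -scaleNr addrC kap_lin kap_v ?inI // eqxx.
  rewrite (kap_low _ i) ?mulr0 ?add0r ?inI //.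
    by rewrite len_aword // ltnW // h_ltm.
  by apply: model_path; apply: leqW.
- move=> [//|i] j /andP[]; rewrite !ltnS => ji ih.
  apply: (kap_low _ j); first exact: inI.
    by rewrite len_aword // ltnW // h_ltm.
  by apply: model_path; apply: (leq_trans ji); apply: leqW.
have U1 : U (b0 (+) odd m) (P m) = - qV *: P m by apply: path_desc P_start m.
have [m' mE] : exists m', m = m'.+1 by case: (m) m_ge2 => // m'; exists m'.
have U2 : U (b0 (+) odd m') (P m) = - qV *: P m.
  have E : opword U b0 m e = - qV *: opword U b0 m' e.
    have := opwordSr U (~~ b0) m' e; rewrite negbK P_start opwordZ -mE => <-.
    by have := model_braid model e; case: (b0) => /= ->.
  move: E; rewrite !(opword_path quad P_start) mE path_ascent.
  rewrite scalerDr scalerA mulNr Defs.mulVq scaleN1r => /eqP.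
  by rewrite eq_sym subr_eq => /eqP ->; rewrite addrAC.
move=> c; have [->|cn] := eqVneq c (b0 (+) odd m); first exact: U1.
have -> : c = b0 (+) odd m'; last exact: U2.
by move: cn; rewrite mE /=; case: c (b0) => [] []; case: odd.
Qed.

End OneSided.

End Necessity.

(** * Classification *)
Section Classification.
Implicit Types I J : {set W}.

(** Heights determine the ideal, so the alternatives of the classification only
    have to be recognized by their heights. *)
Lemma heights_inj I I' h : has_heights I h -> has_heights I' h -> I = I'.
Proof.
move=> hI hI'; apply/setP=> w; have [b [l [lm ->]]] := awordP w.
by rewrite (hI b).2 // (hI' b).2.
Qed.

Lemma heights_eq I h h' : h =1 h' -> has_heights I h -> has_heights I h'.
Proof. by move=> hh hI b; rewrite -hh; apply: hI. Qed.

Lemma heights_of_wgraph I J : wgraph_ideal S I J ->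
  I \subset D S J /\ exists h, has_heights I h.
Proof.
by case=> /weak_idealP[I0 cl] ID _; split=> //; apply: ideal_heights.
Qed.

Lemma mem_segment b b' k i : k < m -> i <= m ->
  (aw b' i \in [set aw b l | l : 'I_k.+1]) = (i == 0) || (b' == b) && (i <= k).
Proof.
move=> km im; apply/imsetP/idP => [[l _ e]|].
  have [|il c] := aword_inj im _ e; first by have := ltn_ord l; lia.
  case: c => [->|->|] //; first by rewrite eqxx il -ltnS ltn_ord orbT.
  by have := ltn_ord l; lia.
case/orP=> [/eqP->|/andP[/eqP-> ik]]; first by exists ord0.
by exists (Ordinal (ik : i < k.+1)).
Qed.

Definition one_height b k (c : bool) : nat := if c == b then k else 0.

Lemma heights_segment b k : k < m ->
  has_heights [set aw b l | l : 'I_k.+1] (one_height b k).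
Proof.
move=> km c; rewrite /one_height; split=> [|i im]; first by case: ifP; lia.
by rewrite mem_segment //; case: (c == b); lia.
Qed.

Lemma heights_D b : has_heights (D S [set g (~~ b)]) (one_height b m.-1).
Proof.
move=> c; rewrite /one_height; split=> [|i im]; first by case: ifP; lia.
by rewrite mem_D1 //; case: (c == b); lia.
Qed.

Lemma heights_segments h k : h < m -> k < m ->
  has_heights ([set aw true l | l : 'I_h.+1] :|: [set aw false l | l : 'I_k.+1])
    (fun b => if b then h else k).
Proof.
move=> hm km b; split=> [|i im]; first by case: b; lia.
by rewrite inE !mem_segment //; case: b; rewrite /=; lia.
Qed.

Lemma heights_setT : has_heights [set: W] (fun _ => m).
Proof. by move=> b; split=> // i im; rewrite inE im. Qed.

Lemma wgraph_ideal_all I : wgraph_ideal S I S <-> I = [set 1%g].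
Proof.
split=> [wI|->]; last exact: wgraph_trivial.
have [] := heights_of_wgraph wI; rewrite D_all => I1 [h hI].
by apply/eqP; rewrite eqEsubset I1 sub1set (heights_1 hI).
Qed.

Lemma wgraph_ideal_one b I : wgraph_ideal S I [set g (~~ b)] <->
  I = D S [set g (~~ b)] \/
  exists k, k + 2 %| m /\ I = [set aw b l | l : 'I_k.+1].
Proof.
split=> [wI|].
  have [/subsetP ID [h hI]] := heights_of_wgraph wI.
  have hD c i : i <= h c -> (i == 0) || (c == b) && (i < m).
    move=> ih; have im : i <= m by apply: leq_trans ih (hI c).1.
    by rewrite -mem_D1 //; apply: ID; rewrite (hI c).2.
  have hb : h b < m by have := hD b (h b) (leqnn _); rewrite eqxx; lia.
  have hE : h =1 one_height b (h b).
    move=> c; rewrite /one_height; case: eqP => [->//|/eqP/negPf cb].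
    by have := hD c (h c) (leqnn _); rewrite cb orbF => /eqP.
  have {}hI := heights_eq hE hI.
  have [hm|hm] := ltnP (h b).+1 m; [right|left]; last first.
    by apply: heights_inj hI _; rewrite (_ : h b = m.-1); [apply: heights_D | lia].
  exists (h b); split; last exact: heights_inj hI (heights_segment _ _).
  have [V [U [v [bar M]]]] := wgraph_model wI.
  have := one_sided_dvd (b0 := b) hI _ M.
  by rewrite /one_height eqxx addn2; apply.
case=> [->|[k [kd ->]]].
  apply: (wgraph_one_sided (heights_D b)); rewrite /one_height ?eqxx; try lia.
  by case: b.
have km : k.+1 < m by have := dvdn_leq (ltnW m_ge2) kd; lia.
apply: (wgraph_one_sided (heights_segment b (ltnW km))); rewrite /one_height ?eqxx.
- by case: b.
- exact: ltnW.
- by rewrite -addn2.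
Qed.

Lemma wgraph_ideal_none I : wgraph_ideal S I set0 <->
  I = [set: W] \/
  exists h k, h + 1 %| m /\ k + 1 %| m /\
    I = [set aw true l | l : 'I_h.+1] :|: [set aw false l | l : 'I_k.+1].
Proof.
split=> [wI|].
  have [_ [h hI]] := heights_of_wgraph wI.
  have hm : (h true == m) = (h false == m).
    have := (hI true).2 _ (leqnn m); rewrite (aword_m true) (hI false).2 //=.
    by have := (hI true).1; have := (hI false).1; lia.
  have [ht|ht] := eqVneq (h true) m; [left|right].
    apply: heights_inj hI _; apply: heights_eq heights_setT.
    by case; [rewrite ht | apply/esym/eqP; rewrite -hm ht].
  have h_lt b : h b < m.
    by rewrite ltn_neqAle (hI b).1 andbT; case: b; rewrite -?hm.
  have [V [U [v [bar M]]]] := wgraph_model wI.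
  exists (h true), (h false); rewrite !addn1 !(regular_dvd hI h_lt M).
  do 2!split=> //; apply: heights_inj hI _.
  by apply: heights_eq (heights_segments (h_lt true) (h_lt false)); case.
case=> [->|[h [k [hd [kd ->]]]]].
  by apply: (wgraph_regular heights_setT) => b; rewrite ltnn.
have hm : h < m by have := dvdn_leq (ltnW m_ge2) hd; lia.
have km : k < m by have := dvdn_leq (ltnW m_ge2) kd; lia.
apply: (wgraph_regular (heights_segments hm km)) => -[] _; rewrite -addn1 //.
Qed.

End Classification.

End Dihedral.

Theorem theorem9p5 (m : nat) (W : finGroupType) (s t : W) (I J : {set W}) :
  2 <= m ->
  coxeter_I2 m s t ->
  J \subset [set s; t] ->
  wgraph_ideal [set s; t] I J <->
  ((* i *)   (I = [set 1%g] /\ J = [set s; t])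
   \/ (* ii *)  (I = D [set s; t] [set s] /\ J = [set s])
   \/ (* iii *) (exists k : nat, k + 2 %| m
              /\ I = [set alt_word s t l | l : 'I_k.+1] /\ J = [set s])
   \/ (* iv *)  (I = D [set s; t] [set t] /\ J = [set t])
   \/ (* v *)   (exists k : nat, k + 2 %| m
              /\ I = [set alt_word t s l | l : 'I_k.+1] /\ J = [set t])
   \/ (* vi *)  (I = [set: W] /\ J = set0)
   \/ (* vii *) (exists h k : nat, h + 1 %| m /\ k + 1 %| m
              /\ I = [set alt_word s t l | l : 'I_h.+1]
                       :|: [set alt_word t s l | l : 'I_k.+1]
              /\ J = set0)).
Proof.
move=> m_ge2 cox JS.
have all := wgraph_ideal_all m_ge2 cox.
have one_s := wgraph_ideal_one m_ge2 cox true.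
have one_t := wgraph_ideal_one m_ge2 cox false.
have none := wgraph_ideal_none m_ge2 cox.
split; last first.
  case=> [[-> ->]|[[-> ->]|[[k [kd [-> ->]]]|[[-> ->]|[[k [kd [-> ->]]]|]]]]].
  - exact/all.
  - by apply/one_s; left.
  - by apply/one_s; right; exists k.
  - by apply/one_t; left.
  - by apply/one_t; right; exists k.
  case=> [[-> ->]|[h [k [hd [kd [-> ->]]]]]]; apply/none; first by left.
  by right; exists h, k.
have : J = set0 \/ J = [set s] \/ J = [set t] \/ J = [set s; t].
  have memJ r : r \in J -> r = s \/ r = t.
    by move/(subsetP JS); rewrite !inE => /orP[]/eqP; auto.
  have [sJ|sJ] := boolP (s \in J); have [tJ|tJ] := boolP (t \in J).
  - right; right; right; apply/eqP; rewrite eqEsubset JS /=.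
    by apply/subsetP=> r; rewrite !inE => /orP[]/eqP->.
  - right; left; apply/setP=> r; rewrite inE; apply/idP/eqP => [rJ|->//].
    by case: (memJ _ rJ) => // rt; rewrite -rt rJ in tJ.
  - right; right; left; apply/setP=> r; rewrite inE; apply/idP/eqP => [rJ|->//].
    by case: (memJ _ rJ) => // rs; rewrite -rs rJ in sJ.
  - left; apply/setP=> r; rewrite inE; apply/negP => rJ.
    by case: (memJ _ rJ) => e; rewrite -e rJ in sJ tJ.
case=> [->|[->|[->|->]]].
- by case/none=> [->|[h [k [hd [kd ->]]]]]; do 5!right; [left | right; exists h, k].
- by case/one_s=> [->|[k [kd ->]]]; right; [left | right; left; exists k].
- by case/one_t=> [->|[k [kd ->]]]; do 3!right; [left | right; left; exists k].
- by case/all; left.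
Qed.
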